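(* Let $X$ be a Banach space and suppose that the linear equation $v'=A(t)v$ admits a general dichotomy with bounds $a,b:\{(t,s)\in[0,+\infty)^2: t\ge s\}\to(0,+\infty)$. Let $f:[0,+\infty)\times X\to X$ be a continuous function such that $f_t=f(t,\cdot):X\to X$ is Lipschitz for each $t\ge 0$ and $f(t,0)=0$ for every $t\ge 0$. Assume that $$\lim_{t\to+\infty} a(t,s)\,b(t,s)=0\quad\text{for every } s\ge 0,$$ $$\alpha=\sup_{t>s\ge 0}\ \frac{1}{a(t,s)}\int_s^t a(t,r)\,a(r,s)\,\mathrm{Lip}(f_r)\,dr<+\infty,$$ $$\beta=\sup_{s\ge 0}\int_s^{+\infty} b(r,s)\,a(r,s)\,\mathrm{Lip}(f_r)\,dr<+\infty.$$ If $$2\alpha+\max\{2\beta,\sqrt{\beta}\}<1,$$ then there is a unique $\phi\in\mathcal X$ such that $$\Psi_\tau(\mathcal V_\phi)\subseteq\mathcal V_\phi\quad\text{for every }\tau\ge 0.$$ Moreover, $$\|\Psi_{t-s}(s,\xi,\phi(s,\xi))-\Psi_{t-s}(s,\bar\xi,\phi(s,\bar\xi))\|\le\frac{2}{1-2\alpha}\,a(t,s)\,\|\xi-\bar\xi\|$$ for every $t\ge s\ge 0$ and every $\xi,\bar\xi\in E_s$.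
   Context: $X$ is a Banach space, $B(X)$ is the space of bounded linear operators on $X$, and $A:[0,+\infty)\to B(X)$ is continuous. The solutions of the linear initial value problem $v'=A(t)v$, $v(s)=v_s$ are assumed to be global in the future, and $T_{t,s}$ ($t\ge s\ge0$) denotes the associated linear evolution operator (so that the solution is $v(t)=T_{t,s}v_s$). Invariant splitting: the equation $v'=A(t)v$ admits an invariant splitting if there exist bounded projections $P_s$ on $X$, $s\ge 0$, such that for all $t\ge s\ge 0$: (S1) $T_{t,s}P_s=P_tT_{t,s}$; (S2) $T_{t,s}(\ker P_s)=\ker P_t$; (S3) $T_{t,s}|_{\ker P_s}:\ker P_s\to\ker P_t$ is invertible with bounded inverse. Put $Q_t=\mathrm{Id}-P_t$, $E_t=P_t(X)$, $F_t=\ker P_t=Q_t(X)$, and identify $E_t\times F_t$ with $E_t\oplus F_t=X$. General dichotomy with bounds $a,b$ (positive functions on $\{(t,s):t\ge s\ge0\}$): the equation admits an invariant splitting such that, for all $t\ge s\ge0$, $\|T_{t,s}P_s\|\le a(t,s)$ and $\|(T_{t,s}|_{F_s})^{-1}Q_t\|\le b(t,s)$. Here $P_t,Q_t,E_t,F_t$ are those of this splitting. $\mathrm{Lip}(f_t)$ denotes the Lipschitz constant of $f_t$. Semiflow: for $v_s=(\xi,\eta)\in E_s\times F_s$, write the unique solution of $v'=A(t)v+f(t,v)$, $v(s)=v_s$ as $(x(t,s,v_s),y(t,s,v_s))\in E_t\times F_t$. For $\tau\ge0$, $\Psi_\tau(s,v_s)=(s+\tau,\,x(s+\tau,s,v_s),\,y(s+\tau,s,v_s))$.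 A difference $\Psi_{t-s}(s,v_s)-\Psi_{t-s}(s,\bar v_s)$ has zero time component, and its norm is the norm in $X$ of the difference of the two solutions at time $t$. $G=\bigcup_{t\ge0}\{t\}\times E_t$. $\mathcal X$ is the space of functions $\phi:G\to X$ such that, for all $(t,\xi),(t,\bar\xi)\in G$: $\phi(t,0)=0$, $\phi(t,\xi)\in F_t$, and $\|\phi(t,\xi)-\phi(t,\bar\xi)\|\le\|\xi-\bar\xi\|$. For $\phi\in\mathcal X$, $\mathcal V_\phi=\{(s,\xi,\phi(s,\xi)):(s,\xi)\in G\}$. *)

(* Defs.v *)
From HB Require Import structures.
From mathcomp Require Import all_boot all_order all_algebra.
From mathcomp Require Import all_classical all_reals all_analysis.

Set Implicit Arguments.
Unset Strict Implicit.
Unset Printing Implicit Defensive.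

Import Order.TTheory GRing.Theory Num.Theory.
Import numFieldNormedType.Exports.

Local Open Scope classical_set_scope.
Local Open Scope ring_scope.

Section Defs.
Context {R : realType} {X : completeNormedModType R}.

(* The operator norm takes values in \bar R, so that it is +oo (and not a
   default value) on unbounded maps. *)
Definition opnorm (L : X -> X) : \bar R :=
  ereal_sup [set `|L x|%:E | x in [set x : X | `|x| <= 1]].

(* A is a norm-continuous map from [0, +oo) to B(X). *)
Definition continuous_family (A : R -> {linear X -> X}) : Prop :=
  (forall t, 0 <= t -> (opnorm (A t) < +oo)%E) /\
  (forall t, 0 <= t ->
     opnorm (fun x => A r x - A t x) @[r --> within `[0, +oo[ (nbhs t)]
       --> 0%E).

(* u solves u' = g(t, u), u(s) = v on [s, +oo).  For continuous g, continuity
   of u at s and the equation on ]s, +oo[ give the one-sided derivative at s. *)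
Definition solution (g : R -> X -> X) (s : R) (v : X) (u : R -> X) : Prop :=
  [/\ u s = v,
      {within `[s, +oo[, continuous u} &
      forall t, s < t -> is_derive t 1 u (g t (u t))].

(* W t s v is the value at time t of a solution starting from v at time s. *)
Definition solution_family (g : R -> X -> X) (W : R -> R -> X -> X) : Prop :=
  forall s v, 0 <= s -> solution g s v (fun t => W t s v).

Definition unique_solutions (g : R -> X -> X) : Prop :=
  forall s v u w, 0 <= s -> solution g s v u -> solution g s v w ->
    forall t, s <= t -> u t = w t.

Definition Q_ (P : R -> {linear X -> X}) (t : R) (x : X) : X := x - P t x.

Definition E_ (P : R -> {linear X -> X}) (t : R) : set X := range (P t).

Definition F_ (P : R -> {linear X -> X}) (t : R) : set X :=
  [set x | P t x = 0].

(* The inverse of T_{t,s} restricted to F_s, as a map F_t -> F_s. *)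
Definition Tinv (T : R -> R -> X -> X) (P : R -> {linear X -> X})
  (t s : R) : X -> X := 'pinv_(fun=> 0) (F_ P s) (T t s).

Definition bounded_projection (L : {linear X -> X}) : Prop :=
  (opnorm L < +oo)%E /\ (forall x, L (L x) = L x).

Definition invariant_splitting (T : R -> R -> X -> X)
    (P : R -> {linear X -> X}) : Prop :=
  (forall s, 0 <= s -> bounded_projection (P s)) /\
  (forall t s, 0 <= s -> s <= t ->
    [/\ forall x, T t s (P s x) = P t (T t s x),
        T t s @` F_ P s = F_ P t,
        set_bij (F_ P s) (F_ P t) (T t s) &
        exists M : R, forall y, F_ P t y -> `|Tinv T P t s y| <= M * `|y|]).

Definition general_dichotomy (T : R -> R -> X -> X)
    (P : R -> {linear X -> X}) (a b : R -> R -> R) : Prop :=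
  invariant_splitting T P /\
  (forall t s, 0 <= s -> s <= t ->
    (opnorm (T t s \o P s) <= (a t s)%:E)%E /\
    (opnorm (Tinv T P t s \o Q_ P t) <= (b t s)%:E)%E).

Definition Lip (g : X -> X) : R := inf [set k : R | 0 <= k /\ k.-lipschitz g].

(* No measurability of a and b is assumed: the library's integral of a
   nonnegative function is the supremum of the integrals of the nonnegative
   simple functions below it, which agrees with the usual one on measurable
   integrands. *)
Definition alpha_ (a : R -> R -> R) (f : R -> X -> X) : \bar R :=
  ereal_sup [set (((a p.1 p.2)^-1)%:E *
    \int[lebesgue_measure]_(r in `[p.2, p.1])
      (a p.1 r * a r p.2 * Lip (f r))%:E)%E
    | p in [set p : R * R | 0 <= p.2 /\ p.2 < p.1]].

Definition beta_ (a b : R -> R -> R) (f : R -> X -> X) : \bar R :=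
  ereal_sup [set (\int[lebesgue_measure]_(r in `[s, +oo[)
      (b r s * a r s * Lip (f r))%:E)%E
    | s in [set s : R | 0 <= s]].

Definition G_ (P : R -> {linear X -> X}) : set (R * X) :=
  [set z | 0 <= z.1 /\ E_ P z.1 z.2].

(* Functions on G are represented by total functions; only their values on G
   matter. *)
Definition calX (P : R -> {linear X -> X}) (phi : R -> X -> X) : Prop :=
  [/\ forall t, 0 <= t -> phi t 0 = 0,
      forall t xi, G_ P (t, xi) -> F_ P t (phi t xi) &
      forall t xi xi', G_ P (t, xi) -> G_ P (t, xi') ->
        `|phi t xi - phi t xi'| <= `|xi - xi'|].

(* E_s x F_s is identified with X through (xi, eta) |-> xi + eta. *)
Definition graph_ (P : R -> {linear X -> X}) (phi : R -> X -> X) :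
  set (R * X) := [set (z.1, z.2 + phi z.1 z.2) | z in G_ P].

Definition Psi (U : R -> R -> X -> X) (tau : R) (z : R * X) : R * X :=
  (z.1 + tau, U (z.1 + tau) z.1 z.2).

Definition graph_invariant (P : R -> {linear X -> X}) (U : R -> R -> X -> X)
    (phi : R -> X -> X) : Prop :=
  forall tau, 0 <= tau -> Psi U tau @` graph_ P phi `<=` graph_ P phi.

End Defs.

(* Main.v *)
Require Import Defs.
From HB Require Import structures.
From mathcomp Require Import all_boot all_order all_algebra.
From mathcomp Require Import all_classical all_reals all_analysis.
From mathcomp Require Import measurable_realfun ring lra.
Import Order.TTheory GRing.Theory Num.Theory.
Import numFieldNormedType.Exports.
Local Open Scope classical_set_scope.
Local Open Scope ring_scope.

Set Implicit Arguments.
Unset Strict Implicit.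
Unset Printing Implicit Defensive.

(** The graphs are obtained by pulling the stable spaces back along the nonlinear
    flow. For a horizon [n], consider at each time [r] in [0, n] the data whose
    solution lies in [E_n] at time [n]. They form the graph over [E_r] of a
    function [Phi n r] with values in [F_r], and these graphs are invariant up to
    time [n]; the function [phi] is their limit as [n] tends to infinity.

    Everything rests on one inequality ([variation_of_constants]). If [L r] is a
    family of operators transported by the linear flow, then along two solutions
    [u], [u'] the vector [L r (u r - u' r)] moves at speed at most
    [|L r (f r (u r) - f r (u' r))|]. With [L r] the linear flow from [r] to [t]
    after [P r], the integral of this speed is controlled by [alpha]; with [L r]
    the backward evolution from [r] to [s] after [Q r], it is controlled by
    [beta]. So, as long as two solutions stay in the cone
    [|Q (u - u')| <= |P (u - u')|], their stable parts decay like [C * a] with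
    [C = 1 / (1 - 2 alpha)] ([stable_decay]); this is the final estimate of the
    theorem. If moreover their unstable parts agree at time [n], then these are at
    most [2 beta C] times the stable parts at the initial time
    ([unstable_slaving]), and [2 beta C < 1].

    The gap between this constant and [1] closes a continuity argument, backwards
    from the horizon ([lipschitz_graph_backward]): if the pulled-back sets are
    graphs with Lipschitz constant at most [1] from [r'] on, the constant at [r']
    is even less than [1], hence it is still at most [1] slightly before [r'], as
    the flow over a short time is close to the identity in the Lipschitz sense
    ([solution_near_identity]). That holds since the Lipschitz
    constant of [f r] is locally integrable in [r], a consequence of
    [alpha < +oo] if [E_0] is not zero ([dichotomy_lip_locally_integrable]). If it
    is zero, so are all the stable spaces ([trivial_stable_space]), and the graphs
    reduce to the zero solution.

    For convergence, let solutions on two graphs of large index, with the same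
    stable part [xi] at time [s], be at distance at most [M * a t s * |xi|] at
    time [t], asymptotically in the indices. Then the two integrals above bound
    the distance of the stable parts by [alpha M a t s |xi|] and that of the
    graphs by [beta M |xi|]; the boundary term at the horizon vanishes because
    [a b] tends to [0]. Since solutions on a graph decay, [M] may be replaced by
    [(2 alpha + C beta) M] ([asymptotic_gap_step]), a smaller bound because
    [sqrt beta < 1 - 2 alpha]. Passing to asymptotic bounds inside the integrals
    is the reverse Fatou lemma. Uniqueness is the same convergence, for the
    alternating sequence of two invariant graphs ([invariant_graph_unique]).

    The integrands that arise from the equation are continuous in time, whereas
    [a] and [b] come without any regularity; their integrals are compared through
    [le_integral_subset_nomeas]. *)

(** * Induction on segments, continuity, and a mean value inequality *)

Section RealInduction.
Context {R : realType}.
Implicit Types (Q : R -> Prop) (r s t : R).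

(** The supremum of the initial segments on which [Q] holds cannot be less than
    [t]: [Q] holds there by the limit hypothesis, and beyond it by the other. *)
Lemma real_induction Q s t : s <= t -> Q s ->
  (forall r, s <= r -> r < t -> Q r ->
    exists2 d : R, 0 < d & forall r', r < r' -> r' < r + d -> r' <= t -> Q r') ->
  (forall r, s < r -> r <= t -> (forall r', s <= r' -> r' < r -> Q r') -> Q r) ->
  Q t.
Proof.
move=> st Qs Qsucc Qlim.
pose Z := [set r | s <= r <= t /\ forall r', s <= r' -> r' <= r -> Q r'].
have Zs : Z s.
  split; first by rewrite lexx.
  by move=> r' sr' r's; have -> : r' = s by apply/le_anti; rewrite r's.
have supZ : has_sup Z.
  by split; [exists s | exists t => r [/andP[]]].
set c := sup Z.
have sc : s <= c by exact: ub_le_sup supZ.2 _ Zs.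
have ct : c <= t by apply: ge_sup; [exists s | move=> r [/andP[]]].
have below r : s <= r -> r < c -> Q r.
  move=> sr rc; have e0 : 0 < c - r by rewrite subr_gt0.
  have [z [_ Zz]] := sup_adherent e0 supZ; rewrite subKr => rz.
  by apply: Zz => //; exact: ltW.
have Qc : Q c.
  have [->//|sc'] := eqVneq c s.
  by apply: Qlim => //; rewrite lt_neqAle eq_sym sc'.
have [<-//|cnt] := eqVneq c t.
have ct' : c < t by rewrite lt_neqAle cnt.
have [d d0 Qd] := Qsucc c sc ct' Qc.
pose z := Num.min (c + d / 2) t.
have cz : c < z by rewrite /z lt_min ct' andbT; lra.
have zt : z <= t by rewrite /z ge_min lexx orbT.
have zd : z < c + d by rewrite /z gt_min; apply/orP; left; lra.
have : Z z.
  split; first by rewrite (le_trans sc (ltW cz)).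
  move=> r' sr' r'z; have [r'c|cr'|->//] := ltgtP r' c; first exact: below.
  by apply: Qd => //; [exact: le_lt_trans zd | exact: le_trans zt].
by move=> /(ub_le_sup supZ.2); rewrite -/c leNgt cz.
Qed.

(** Cousin's lemma, as an induction principle on intervals. Every passage from
    short times to a compact time interval below is an instance of it. *)
Lemma cousin (Q : R -> R -> Prop) s t : s <= t ->
  (forall r1 r2 r3, s <= r1 -> r1 <= r2 -> r2 <= r3 -> r3 <= t ->
     Q r1 r2 -> Q r2 r3 -> Q r1 r3) ->
  (forall c, s <= c -> c <= t -> exists2 d : R, 0 < d &
     forall r r', s <= r -> r' <= t -> c - d < r -> r <= c -> c <= r' ->
       r' < c + d -> Q r r') ->
  Q s t.
Proof.
move=> st Qcat Qtag; apply: (@real_induction (Q s) s t st) => [|r sr rt Qsr|r sr rt Qlt].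
- have [d d0 Qd] := Qtag s (lexx s) st.
  by apply: Qd => //; lra.
- have [d d0 Qd] := Qtag r sr (ltW rt).
  exists d => // r' rr' r'd r't; apply: (Qcat s r r') => //; first exact: ltW.
  by apply: Qd => //; [lra | exact: ltW].
- have [d d0 Qd] := Qtag r (ltW sr) rt.
  pose z := Num.max s (r - d / 2).
  have sz : s <= z by rewrite le_max lexx.
  have zr : z < r by rewrite gt_max sr /=; lra.
  apply: (Qcat s z r) => //; [exact: ltW | exact: Qlt |].
  apply: Qd => //; [|exact: ltW|lra].
  by rewrite /z lt_max; apply/orP; right; lra.
Qed.

End RealInduction.

Section ContI.
Context {R : realType}.

(** Continuity on [s, t] with an explicit modulus, the form in which the estimates
    below produce and consume it; [contI_within] relates it to the subspace
    topology. *)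
Definition contI {V : normedModType R} (s t : R) (z : R -> V) : Prop :=
  forall r, s <= r -> r <= t -> forall e : R, 0 < e ->
  exists2 d : R, 0 < d &
    forall r', s <= r' -> r' <= t -> `|r' - r| < d -> `|z r' - z r| < e.

Lemma contI_within {V : normedModType R} s t (z : R -> V) :
  contI s t z <-> {within `[s, t], continuous z}.
Proof.
split=> [cz|/subspace_continuousP cz r sr rt e e0].
  apply/subspace_continuousP => r; rewrite /= in_itv /= => /andP[sr rt].
  apply/cvgrPdist_lt => e e0; have [d d0 dP] := cz r sr rt e e0.
  rewrite near_withinE; apply/nbhs_ballP; exists d => //= r' rr'.
  rewrite in_itv /= => /andP[sr' r't].
  by rewrite distrC dP// distrC.
have : `[s, t]%classic r by rewrite /= in_itv /= sr.
move=> /cz /cvgrPdist_lt/(_ e e0); rewrite near_withinE => /nbhs_ballP[d /= d0 dP].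
exists d => // r' sr' r't r'r; rewrite distrC; apply: dP.
  by rewrite /= /ball /= distrC.
by rewrite /= in_itv /= sr'.
Qed.

Lemma contI_sub {V : normedModType R} s t s' t' (z : R -> V) :
  s <= s' -> t' <= t -> contI s t z -> contI s' t' z.
Proof.
move=> ss' tt' cz r sr rt e e0.
have [||d d0 dP] := cz r _ _ e e0; [exact: le_trans sr|exact: le_trans tt'|].
exists d => // r' sr' r't; apply: dP; [exact: le_trans sr'|exact: le_trans tt'].
Qed.

Lemma contI_norm {V : normedModType R} s t (z : R -> V) :
  contI s t z -> contI s t (fun r => `|z r|).
Proof.
move=> cz r sr rt e e0; have [d d0 dP] := cz r sr rt e e0.
exists d => // r' sr' r't r'r.
by apply: le_lt_trans (dP _ sr' r't r'r); exact: ler_dist_dist.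
Qed.

Lemma contI_cst {V : normedModType R} s t (c : V) : contI s t (fun=> c).
Proof. by move=> r _ _ e e0; exists 1 => // r' _ _ _; rewrite subrr normr0. Qed.

Lemma contID {V : normedModType R} s t (y z : R -> V) :
  contI s t y -> contI s t z -> contI s t (fun r => y r + z r).
Proof.
move=> cy cz r sr rt e e0; have e20 : 0 < e / 2 by lra.
have [d d0 dP] := cy r sr rt _ e20; have [d' d'0 d'P] := cz r sr rt _ e20.
exists (Num.min d d') => [|r' sr' r't]; first by rewrite lt_min d0.
rewrite lt_min => /andP[h1 h2]; rewrite opprD addrACA [e]splitr.
by rewrite (le_lt_trans (ler_normD _ _))// ltrD// (dP, d'P).
Qed.

Lemma contIN {V : normedModType R} s t (y : R -> V) :
  contI s t y -> contI s t (fun r => - y r).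
Proof.
move=> cy r sr rt e e0; have [d d0 dP] := cy r sr rt _ e0.
by exists d => // r' sr' r't /dP -/(_ sr' r't); rewrite -opprD normrN.
Qed.

Lemma contIB {V : normedModType R} s t (y z : R -> V) :
  contI s t y -> contI s t z -> contI s t (fun r => y r - z r).
Proof. by move=> cy cz; apply: contID => //; exact: contIN. Qed.

Lemma contI_bounded {V : normedModType R} s t (z : R -> V) : s <= t ->
  contI s t z -> exists2 M : R, 0 <= M & forall r, s <= r -> r <= t -> `|z r| <= M.
Proof.
move=> st /contI_norm/contI_within cz.
have [c _ cP] := EVT_max st cz.
exists `|z c| => // r sr rt; apply: cP; by rewrite in_itv /= sr.
Qed.

(** Real induction absorbs the error terms [e * (r' - r)]. Only increments to the
    right are constrained, because the flow compares times forwards; the initial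
    time, where a solution need not be differentiable, is reached by
    continuity. *)
Lemma mean_value_majorant {V : normedModType R} s t (z : R -> V) (H : R -> R) :
  s <= t -> contI s t z ->
  (forall r r', s <= r -> r <= r' -> r' <= t -> H r <= H r') ->
  (forall r, s < r -> r < t -> forall e : R, 0 < e -> exists2 d : R, 0 < d &
     forall r', r < r' -> r' < r + d -> r' <= t ->
       `|z r' - z r| <= H r' - H r + e * (r' - r)) ->
  `|z t - z s| <= H t - H s.
Proof.
move=> st cz Hmono Hz.
have open_start s' : s < s' -> s' <= t -> `|z t - z s'| <= H t - H s'.
  move=> ss' s't.
  suff He e : 0 < e -> `|z t - z s'| <= H t - H s' + e * (t - s').
    apply/ler_addgt0Pr => e e0.
    have k0 : 0 < e / (t - s' + 1) by rewrite divr_gt0//; lra.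
    apply: (le_trans (He _ k0)); rewrite lerD2l -mulrA ler_piMr ?(ltW e0)//.
    by rewrite ler_pdivrMl; lra.
  move=> e0.
  apply: (@real_induction _
    (fun r => `|z r - z s'| <= H r - H s' + e * (r - s')) s' t) => //.
  - by rewrite !subrr normr0 mulr0 addr0.
  - move=> r s'r rt Qr; have [|d d0 dP] := Hz r _ rt e e0; first by lra.
    exists d => // r' rr' r'd r't.
    have := dP r' rr' r'd r't; have := ler_distD (z r) (z r') (z s').
    by nra.
  - move=> r s'r rt Qr; apply/ler_addgt0Pr => k k0.
    have [||d d0 dP] := cz r _ _ k k0; [lra|lra|].
    pose r' := Num.max s' (r - d / 2).
    have s'r' : s' <= r' by rewrite le_max lexx.
    have r'r : r' < r by rewrite gt_max s'r /=; lra.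
    have r'd : r - d / 2 <= r' by rewrite le_max lexx orbT.
    have := Qr r' s'r' r'r.
    have : `|z r' - z r| < k.
      by apply: dP; [lra|lra|]; rewrite distrC ger0_norm; lra.
    have Hrr' : H r' <= H r by apply: Hmono; lra.
    have := ler_distD (z r') (z r) (z s'); rewrite [`|z r - z r'|]distrC.
    by nra.
have [<-|sNt] := eqVneq s t; first by rewrite !subrr normr0.
have st' : s < t by rewrite lt_neqAle sNt.
apply/ler_addgt0Pr => k k0; have [||d d0 dP] := cz s _ _ k k0; [lra|lra|].
pose s' := Num.min t (s + d / 2).
have ss' : s < s' by rewrite lt_min st' /=; lra.
have s't : s' <= t by rewrite ge_min lexx.
have s'd : s' <= s + d / 2 by rewrite ge_min lexx orbT.
have := open_start s' ss' s't.
have : `|z s' - z s| < k by apply: dP; [lra|lra|]; rewrite ger0_norm; lra.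
have : H s <= H s' by apply: Hmono; lra.
have := ler_distD (z s') (z t) (z s).
by lra.
Qed.

End ContI.

(** * Integrals with majorants that are not measurable *)

(** The integral of a nonnegative function is the supremum of the integrals of the
    nonnegative simple functions below it, and these only become more numerous
    when the function, extended by zero, increases. *)
Lemma le_integral_subset_nomeas d (T : measurableType d) (R : realType)
    (mu : {measure set T -> \bar R}) (A D : set T) (F G : T -> \bar R) :
  A `<=` D -> (forall x, A x -> (0 <= F x)%E) ->
  (forall x, D x -> (0 <= G x)%E) -> (forall x, A x -> (F x <= G x)%E) ->
  (\int[mu]_(x in A) F x <= \int[mu]_(x in D) G x)%E.
Proof.
move=> AD F0 G0 FG.
rewrite !ge0_integralE//; apply: le_ereal_sup => _ [h hF <-]; exists h => // x.
apply: le_trans (hF x) _; rewrite /patch; case: ifPn => [|_].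
  by rewrite inE => Ax; rewrite ifT ?inE; [exact: FG | exact: AD].
by case: ifPn => //; rewrite inE => /G0.
Qed.

Lemma le_integral_nomeas d (T : measurableType d) (R : realType)
    (mu : {measure set T -> \bar R}) (D : set T) (F G : T -> \bar R) :
  (forall x, D x -> (0 <= F x)%E) -> (forall x, D x -> (F x <= G x)%E) ->
  (\int[mu]_(x in D) F x <= \int[mu]_(x in D) G x)%E.
Proof.
move=> F0 FG; apply: le_integral_subset_nomeas => // x Dx.
exact: le_trans (F0 x Dx) (FG x Dx).
Qed.

(** The constant is moved to the side of [F], the only measurable function
    here. *)
Lemma integral_domination d (T : measurableType d) (R : realType)
    (mu : {measure set T -> \bar R}) (D : set T) (F g : T -> R) (c M : R) :
  measurable D -> measurable_fun D F -> 0 <= c ->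
  (forall x, D x -> 0 <= F x) -> (forall x, D x -> F x <= c * g x) ->
  (\int[mu]_(x in D) (g x)%:E <= M%:E)%E ->
  (\int[mu]_(x in D) (F x)%:E <= (c * M)%:E)%E.
Proof.
move=> mD mF + F0 Fg gM; rewrite le_eqVlt => /predU1P[c0|c0].
  rewrite -c0 mul0r integral0_eq// => x Dx; congr EFin.
  by apply/le_anti; rewrite F0// andbT (le_trans (Fg x Dx))// -c0 mul0r.
have -> : (\int[mu]_(x in D) (F x)%:E =
           c%:E * \int[mu]_(x in D) (c^-1 * F x)%:E)%E.
  rewrite -ge0_integralZl_EFin//.
  - by apply: eq_integral => r _; rewrite -EFinM mulVKf// gt_eqF.
  - by move=> x Dx; rewrite lee_fin mulr_ge0 ?F0// invr_ge0 ltW.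
  - by apply/measurable_EFinP; apply: measurable_funM.
  - exact: ltW.
rewrite EFinM lee_wpmul2l ?lee_fin ?(ltW c0)//; apply: le_trans gM.
apply: le_integral_nomeas => x Dx.
  by rewrite lee_fin mulr_ge0 ?F0// invr_ge0 ltW.
by rewrite lee_fin ler_pdivrMl// Fg.
Qed.

Section Integral.
Context {R : realType}.
Local Notation mu := (@lebesgue_measure R).

Lemma contI_integrable s t (h : R -> R) : contI s t h ->
  mu.-integrable `[s, t] (EFin \o h).
Proof.
move=> /contI_within ch; apply: continuous_compact_integrable => //.
exact: segment_compact.
Qed.

Lemma contI_measurable s t (h : R -> R) : contI s t h ->
  measurable_fun `[s, t] h.
Proof. by move=> /contI_integrable/measurable_int/measurable_EFinP. Qed.

(** The increments of the indefinite integral of the continuous function [h] are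
    at least [(h r - e) * (r' - r)] near [r]. *)
Lemma mean_value_integral {V : normedModType R} s t (z : R -> V) (h : R -> R) :
  s <= t -> contI s t z -> contI s t h ->
  (forall r, s <= r -> r <= t -> 0 <= h r) ->
  (forall r, s < r -> r < t -> forall e : R, 0 < e -> exists2 d : R, 0 < d &
     forall r', r < r' -> r' < r + d -> r' <= t ->
       `|z r' - z r| <= (h r + e) * (r' - r)) ->
  (`|z t - z s|%:E <= \int[mu]_(r in `[s, t]) (h r)%:E)%E.
Proof.
move=> st cz ch h0 hz.
have ih := contI_integrable ch.
pose H r := \int[mu]_(x in `[s, r]) h x.
have Hdiff r r' : s <= r -> r <= r' -> r' <= t ->
    H r' - H r = \int[mu]_(x in `]r, r']) h x.
  move=> sr rr' r't; apply: Rintegral_itvB; rewrite ?bnd_simp//.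
  apply: integrableS ih => // x /=; rewrite !in_itv /= => /andP[-> /=].
  by move/le_trans; apply.
have iht : (\int[mu]_(r in `[s, t]) (h r)%:E = (H t)%:E)%E.
  by rewrite /H /Rintegral fineK//; exact: integrable_fin_num.
have Hs : H s = 0 by rewrite /H set_itv1 Rintegral_set1.
have -> : (\int[mu]_(r in `[s, t]) (h r)%:E = (H t - H s)%:E)%E.
  by rewrite iht Hs subr0.
rewrite lee_fin; apply: mean_value_majorant => //.
  move=> r r' sr rr' r't; rewrite -subr_ge0 Hdiff//; apply: Rintegral_ge0 => x.
  by rewrite /= in_itv /= => /andP[rx xr']; apply: h0; lra.
move=> r sr rt e e0; have e20 : 0 < e / 2 by lra.
have [d d0 dP] := hz r sr rt _ e20.
have [||d' d'0 d'P] := ch r _ _ _ e20; [lra|lra|].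
exists (Num.min d d') => [|r' rr']; first by rewrite lt_min d0.
rewrite -ltrBlDl lt_min => /andP[r'd r'd'] r't.
have zle := dP r' rr' ltac:(lra) r't.
suff Hge : (h r - e / 2) * (r' - r) <= H r' - H r by nra.
rewrite Hdiff//; [|lra|lra].
have mrr' : mu (`]r, r']%classic : set R) = (r' - r)%:E.
  by rewrite lebesgue_measure_itv /= lte_fin rr' -EFinB.
have -> : (h r - e / 2) * (r' - r) = \int[mu]_(x in `]r, r']) (h r - e / 2).
  rewrite Rintegral_cst//; congr (_ * _).
  exact: (congr1 fine (esym mrr')).
apply: le_Rintegral => //.
- apply: integrableS (contI_integrable (@contI_cst _ _ r r' (h r - e / 2))) => //.
  by move=> x; rewrite /= !in_itv /= => /andP[rx ->]; rewrite ltW.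
- apply: integrableS ih => // x /=; rewrite !in_itv /= => /andP[rx xr'].
  by apply/andP; split; lra.
- move=> x; rewrite /= in_itv /= => /andP[rx xr'].
  have : `|h x - h r| < e / 2 by apply: d'P; [lra|lra|rewrite gtr0_norm; lra].
  by rewrite ltr_distl => /andP[+ _] => /ltW.
Qed.

(** The form in which the dichotomy bounds enter: the speed is at most the
    continuous function [h], while the majorant [g] is arbitrary. *)
Lemma mean_value_domination {V : normedModType R} s t (z : R -> V)
    (h g : R -> R) (c M : R) :
  s <= t -> contI s t z -> contI s t h ->
  (forall r, s <= r -> r <= t -> 0 <= h r) ->
  (forall r, s < r -> r < t -> forall e : R, 0 < e -> exists2 d : R, 0 < d &
     forall r', r < r' -> r' < r + d -> r' <= t ->
       `|z r' - z r| <= (h r + e) * (r' - r)) ->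
  0 <= c -> (forall r, s <= r -> r <= t -> h r <= c * g r) ->
  (\int[mu]_(r in `[s, t]) (g r)%:E <= M%:E)%E ->
  `|z t - z s| <= c * M.
Proof.
move=> st cz ch h0 hz c0 hg gM; rewrite -lee_fin.
apply: le_trans (mean_value_integral st cz ch h0 hz) _.
apply: integral_domination gM => //; first exact: contI_measurable.
  by move=> r; rewrite /= in_itv /= => /andP[]; exact: h0.
by move=> r; rewrite /= in_itv /= => /andP[]; exact: hg.
Qed.

(** The suprema of the tails of [h] decrease to a measurable limit below [c * g],
    and they are integrable since they lie below [K * g]: dominated convergence
    applies. *)
Lemma reverse_fatou_domination d (T : measurableType d)
    (nu : {measure set T -> \bar R}) (D : set T)
    (h : nat -> T -> R) (g : T -> R) (K c M : R) :
  measurable D -> (forall n, measurable_fun D (h n)) ->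
  (forall n x, D x -> 0 <= h n x) -> 0 <= K ->
  (forall x, D x -> 0 <= g x) -> (forall n x, D x -> h n x <= K * g x) ->
  (\int[nu]_(x in D) (g x)%:E <= M%:E)%E -> 0 <= c ->
  (forall x, D x -> forall e : R, 0 < e ->
     exists N, forall n, (N <= n)%N -> h n x <= c * g x + e) ->
  forall e : R, 0 < e ->
     exists N, forall n, (N <= n)%N ->
       (\int[nu]_(x in D) (h n x)%:E <= (c * M + e)%:E)%E.
Proof.
move=> mD mh h0 K0 g0 hK gM c0 hc e e0.
have ub x : D x -> has_ubound (range (h ^~ x)).
  by move=> Dx; exists (K * g x) => _ [n _ <-]; exact: hK.
have lb x : D x -> has_lbound (range (h ^~ x)).
  by move=> Dx; exists 0 => _ [n _ <-]; exact: h0.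
pose H n x := sups (h ^~ x) n.
pose L x := limn_sup (h ^~ x).
have mH n : measurable_fun D (H n) by exact: measurable_fun_sups.
have mL : measurable_fun D L by exact: measurable_fun_limn_sup.
have hH n x : D x -> h n x <= H n x.
  by move=> Dx; apply: ub_le_sup; [exact/has_ubound_sdrop/ub | exists n => /=].
have Hle n x B : D x -> (forall m, (n <= m)%N -> h m x <= B) -> H n x <= B.
  by move=> Dx hB; apply: ge_sup; [exists (h n x), n => /= |
    move=> _ [m /= nm <-]; exact: hB].
have H0 n x : D x -> 0 <= H n x.
  by move=> Dx; apply: le_trans (hH n x Dx); exact: h0.
have HL x : D x -> H ^~ x @ \oo --> L x.
  move=> Dx; have cH := cvg_sups_inf (ub x Dx) (lb x Dx).
  by rewrite /L /limn_sup; move/cvg_lim : (cH) => ->.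
have Hmono n x : D x -> H n x <= H 0%N x.
  by move=> Dx; apply: nonincreasing_sups => //; exact: ub.
have L0 x : D x -> 0 <= L x.
  move=> Dx; have cH : cvgn (H ^~ x) by apply/cvg_ex; exists (L x); exact: HL.
  have <- : limn (H ^~ x) = L x by apply/cvg_lim => //; exact: HL.
  by apply: limr_ge => //; apply: nearW => n; exact: H0.
have Lle x : D x -> L x <= c * g x.
  move=> Dx; apply/ler_addgt0Pr => k k0; have [N NP] := hc x Dx k k0.
  have <- : limn (H ^~ x) = L x by apply/cvg_lim => //; exact: HL.
  apply: limr_le; first by apply/cvg_ex; exists (L x); exact: HL.
  exists N => // n /= Nn; apply: Hle => // m nm; apply: NP.
  exact: leq_trans nm.
have iH0 : nu.-integrable D (EFin \o H 0%N).
  apply/integrableP; split; first exact/measurable_EFinP.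
  apply: (@le_lt_trans _ _ (K * M)%:E); last exact: ltry.
  rewrite (eq_integral (EFin \o H 0%N)); last first.
    by move=> x; rewrite inE => Dx; rewrite /= ger0_norm// H0.
  apply: integral_domination gM => //; first by move=> x; exact: H0.
  by move=> x Dx; apply: Hle => // m _; exact: hK.
have cvgI : (\int[nu]_(x in D) (H n x)%:E)%E @[n --> \oo] -->
    (\int[nu]_(x in D) (L x)%:E)%E.
  have [||||| _ _ //] := @dominated_convergence _ _ _ nu D mD
    (fun n => EFin \o H n) (EFin \o L) (EFin \o H 0%N).
  - by move=> n; exact/measurable_EFinP.
  - exact/measurable_EFinP.
  - apply: aeW => x Dx; apply: cvg_EFin; first exact: nearW.
    exact: HL.
  - exact: iH0.
  - apply: aeW => x n Dx; rewrite /= lee_fin ger0_norm; last exact: H0.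
    exact: Hmono.
have IL : (\int[nu]_(x in D) (L x)%:E < (c * M + e)%:E)%E.
  apply: (@le_lt_trans _ _ (c * M)%:E); last by rewrite lte_fin ltrDl.
  exact: integral_domination gM.
have /cvgI [N _ NP] : nbhs (\int[nu]_(x in D) (L x)%:E)%E
    [set y | (y < (c * M + e)%:E)%E].
  by apply: open_nbhs_nbhs; split => //; exact: open_ereal_lt_ereal.
exists N => n Nn; apply: le_trans (ltW (NP n Nn)).
apply: ge0_le_integral => //.
- by move=> x Dx; rewrite lee_fin h0.
- exact/measurable_EFinP.
- exact/measurable_EFinP.
- by move=> x Dx; rewrite lee_fin hH.
Qed.

End Integral.

(** * The Lipschitz constants of the field as a function of time *)

Section Mass.
Context {R : realType}.
Local Notation mu := (@lebesgue_measure R).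

(** The restrictions of [l] to shrinking punctured balls around [c] tend to zero
    pointwise; removing [c] costs nothing. *)
Lemma integral_local_small (l : R -> R) (p q M : R) : measurable_fun `[p, q] l ->
  (forall r, 0 <= l r) ->
  (\int[mu]_(r in `[p, q]) (l r)%:E <= M%:E)%E ->
  forall c (e : R), 0 < e -> exists2 d : R, 0 < d & forall r r', p <= r -> r' <= q ->
    c - d < r -> r' < c + d -> (\int[mu]_(x in `[r, r']) (l x)%:E <= e%:E)%E.
Proof.
move=> ml l0 lM c e e0.
pose B n : set R := ball c (n.+1%:R^-1) `\ c.
have mB n : measurable (B n).
  by apply: measurableD; [exact: measurable_ball | exact: measurable_set1].
pose h n x := l x * \1_(B n) x.
have hin n x : x \in B n -> h n x = l x.
  by move=> xB; rewrite /h indicE xB mulr1.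
have hout n x : x \notin B n -> h n x = 0.
  by move=> xB; rewrite /h indicE (negbTE xB) mulr0.
have h0 n x : 0 <= h n x by rewrite mulr_ge0.
have [|||||| N NP] := @reverse_fatou_domination R _ _ mu `[p, q] h l 1 0 M
  _ _ _ ler01 _ _ lM (lexx 0) _ e e0.
- by [].
- move=> n; rewrite /h; apply: measurable_funM => //.
  exact: measurable_funTS (measurable_indic (mB n)).
- by [].
- by [].
- move=> n x _; rewrite mul1r; have [/hin->|/hout->] := boolP (x \in B n) => //.
- move=> x _ k k0; have [->|xc] := eqVneq x c.
    exists 0%N => n _; rewrite hout ?mul0r ?add0r ?ltW//.
    by apply/negP; rewrite inE => -[_]; exact.
  have d0 : 0 < `|x - c| by rewrite normr_gt0 subr_eq0.
  have [N _ NP] := near_infty_natSinv_lt (PosNum d0).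
  exists N => n Nn; rewrite hout ?mul0r ?add0r ?ltW//.
  apply/negP; rewrite inE => -[]; rewrite /ball /= distrC => xn _.
  by have := NP n Nn; rewrite /= ltNge (ltW xn).
rewrite mul0r add0r in NP.
exists (N.+1%:R^-1) => [|r r' pr r'q cr r'c]; first by rewrite invr_gt0.
apply: le_trans (NP N (leqnn N)).
have sub : `[r, r'] `<=` `[p, q].
  move=> x; rewrite /= !in_itv /= => /andP[rx xr'].
  by rewrite (le_trans pr) //= (le_trans xr').
rewrite -(@integral_setD1 _ _ c); last 2 first.
- by apply: measurableD => //; exact: measurable_set1.
- apply/measurable_EFinP; apply: measurable_funS ml => //.
  by move=> x [/sub].
apply: le_integral_subset_nomeas.
- by move=> x [/sub].
- by move=> x _; rewrite lee_fin.
- by move=> x _; rewrite lee_fin.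
- move=> x [xrr' xc]; rewrite hin// inE; split=> //.
  move: xrr'; rewrite /= in_itv /= => /andP[rx xr'].
  rewrite /ball /= ltr_distl; move: (N.+1%:R^-1) cr r'c => k cr r'c.
  by apply/andP; split; lra.
Qed.

End Mass.

Section LipschitzConstant.
Context {R : realType} {X : completeNormedModType R}.

Lemma lipschitz_ex (g : X -> X) : [lipschitz g x | x in setT] ->
  exists2 k : R, 0 <= k & forall x y, `|g x - g y| <= k * `|x - y|.
Proof.
move=> lg; near (pinfty_nbhs R) => k; exists k; first by near: k; exact: nbhs_pinfty_ge.
have : k.-lipschitz g by near: k.
by move=> kl x y; exact: (kl (x, y)).
Unshelve. all: by end_near. Qed.

Lemma Lip_ge0 (g : X -> X) : 0 <= Lip g.
Proof.
rewrite /Lip; set Z := [set k | _].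
have [[k Zk]|/set0P/negP] := pselect (Z !=set0).
  by apply: lb_le_inf; [exists k | move=> k' []].
by rewrite negbK => /eqP->; rewrite inf0.
Qed.

Lemma Lip_le (g : X -> X) (k : R) : 0 <= k ->
  (forall x y, `|g x - g y| <= k * `|x - y|) -> Lip g <= k.
Proof.
move=> k0 gk; apply: ge_inf; first by exists 0 => ? [].
by split => // -[x y] _ /=; exact: gk.
Qed.

Lemma Lip_bound (g : X -> X) x y : [lipschitz g x | x in setT] ->
  `|g x - g y| <= Lip g * `|x - y|.
Proof.
move=> lg; have [k k0 gk] := lipschitz_ex lg.
have [->|xy] := eqVneq x y; first by rewrite !subrr normr0 mulr0.
have xy0 : 0 < `|x - y| by rewrite normr_gt0 subr_eq0.
rewrite -ler_pdivrMr//; apply: lb_le_inf.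
  by exists k; split => // -[u v] _; exact: gk.
by move=> k' [k'0 gk']; rewrite ler_pdivrMr//; exact: (gk' (x, y)).
Qed.

(** [Lip (f r)] is a supremum of functions of [r] that are continuous, hence is
    measurable; the clamping at [0] only extends it to the real line. *)
Lemma measurable_Lip (f : R -> X -> X) :
  (forall t, 0 <= t -> [lipschitz f t x | x in setT]) ->
  (forall t x, 0 <= t -> forall e : R, 0 < e -> exists2 d : R, 0 < d &
     forall t' x', 0 <= t' -> `|t' - t| < d -> `|x' - x| < d ->
       `|f t' x' - f t x| < e) ->
  measurable_fun [set: R] (fun r : R => Lip (f (Num.max r 0))).
Proof.
move=> lf cf; apply/measurable_EFinP.
have pos r : 0 <= Num.max r 0 :> R by rewrite le_max lexx orbT.
apply: lower_semicontinuous_measurable => r a; rewrite lte_fin => ar.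
have [a0|a0] := ltP a 0.
  by exists setT; [exact: filterT | move=> y _; rewrite lte_fin (lt_le_trans a0)// Lip_ge0].
have [x [y xya]] : exists x y,
    a * `|x - y| < `|f (Num.max r 0) x - f (Num.max r 0) y|.
  apply/not_existsP => nx; move: ar; rewrite ltNge => /negP; apply.
  apply: Lip_le => // x y; rewrite leNgt; apply/negP => h.
  by apply: (nx x); exists y.
set c := a * _ in xya; set b := `|f _ x - _| in xya.
have e0 : 0 < (b - c) / 2 by lra.
have [d d0 dP] := cf _ x (pos r) _ e0.
have [d' d'0 d'P] := cf _ y (pos r) _ e0.
exists (ball r (Num.min d d')); first by apply: nbhsx_ballx; rewrite lt_min d0.
move=> r'; rewrite /ball /= lt_min => /andP[rd rd']; rewrite lte_fin.
have clamp : `|Num.max r' 0 - Num.max r 0| <= `|r - r'|.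
  have := ler_norm (r - r'); have := ler_norm (r' - r); rewrite [`|r' - r|]distrC.
  by rewrite ler_norml !maxEle; case: (leP r' 0); case: (leP r 0); lra.
have h1 : `|f (Num.max r' 0) x - f (Num.max r 0) x| < (b - c) / 2.
  by apply: dP => //; [exact: le_lt_trans clamp rd | rewrite subrr normr0].
have h2 : `|f (Num.max r' 0) y - f (Num.max r 0) y| < (b - c) / 2.
  by apply: d'P => //; [exact: le_lt_trans clamp rd' | rewrite subrr normr0].
have xy : x != y.
  apply/eqP => xy; move: xya; rewrite /c /b xy !subrr normr0 mulr0.
  by rewrite ltxx.
have xy0 : 0 < `|x - y| by rewrite normr_gt0 subr_eq0.
rewrite -(ltr_pM2r xy0) -/c.
apply: lt_le_trans (Lip_bound _ _ (lf _ (pos r'))).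
have : b <= `|f (Num.max r' 0) x - f (Num.max r 0) x| +
    (`|f (Num.max r' 0) x - f (Num.max r' 0) y| +
     `|f (Num.max r' 0) y - f (Num.max r 0) y|).
  rewrite [X in X + _]distrC /b.
  apply: le_trans (ler_distD (f (Num.max r' 0) x) _ _) _; rewrite lerD2l.
  exact: ler_distD.
by lra.
Qed.

End LipschitzConstant.

(** * Solutions of differential equations *)

(** Iterating [M |-> c + k * M], a contraction with fixed point [c / (1 - k)]. *)
Lemma iterate_improvement (R : realType) (B : R -> Prop) (c k M0 : R) :
  0 <= c -> 0 <= k -> k < 1 -> 0 <= M0 -> B M0 ->
  (forall M, 0 <= M -> B M -> B (c + k * M)) ->
  forall e : R, 0 < e -> exists M, [/\ 0 <= M, M <= c / (1 - k) + e & B M].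
Proof.
move=> c0 k0 k1 M00 BM0 Bstep e e0.
have k1' : 0 < 1 - k by lra.
have fix_c : c + k * (c / (1 - k)) = c / (1 - k).
  by rewrite mulrA -[X in X + _](mulfK (lt0r_neq0 k1')) -mulrDl; congr (_ / _); ring.
pose a n := c / (1 - k) + k ^+ n * `|M0 - c / (1 - k)|.
have iterB n : exists M, [/\ 0 <= M, M <= a n & B M].
  elim: n => [|n [M [M0' Ma BM]]].
    exists M0; split=> //; rewrite /a expr0 mul1r.
    by have := ler_norm (M0 - c / (1 - k)); lra.
  exists (c + k * M); split; [by rewrite addr_ge0 ?mulr_ge0| |exact: Bstep].
  have -> : a n.+1 = c + k * a n by rewrite /a mulrDr addrA fix_c exprS mulrA.
  by rewrite lerD2l ler_wpM2l.
have [n kn] : exists n, k ^+ n * `|M0 - c / (1 - k)| < e.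
  have b0 : 0 < `|M0 - c / (1 - k)| + 1 by rewrite ltr_wpDl.
  have k1n : `|k| < 1 by rewrite ger0_norm.
  have e'0 : 0 < e / (`|M0 - c / (1 - k)| + 1) by rewrite divr_gt0.
  have := cvg_expr k1n; move=> /cvgrPdist_lt/(_ _ e'0) [n _ nP].
  exists n; have := nP n (leqnn n); rewrite /= sub0r normrN ger0_norm ?exprn_ge0//.
  rewrite ltr_pdivlMr// => h; apply: le_lt_trans h.
  by rewrite ler_wpM2l ?exprn_ge0// lerDl.
have [M [M0' Ma BM]] := iterB n; exists M; split => //.
by apply: le_trans Ma _; rewrite lerD2l ltW.
Qed.

Section Solutions.
Context {R : realType} {X : completeNormedModType R}.
Implicit Types (u w : R -> X) (g : R -> X -> X).

Lemma is_derive_linear_approx u (r : R) (k : X) : is_derive r 1 u k ->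
  forall e : R, 0 < e -> exists2 d : R, 0 < d &
    forall r', `|r' - r| < d -> `|u r' - u r - (r' - r) *: k| <= e * `|r' - r|.
Proof.
move=> [du uk] e e0; have /cvgrPdist_lt/(_ e e0) := du.
rewrite near_withinE => /nbhs_ballP [d /= d0 dP]; exists d => // r' r'd.
have [->|rr'] := eqVneq r' r; first by rewrite !subrr scale0r subr0 !normr0 mulr0.
have r'0 : r' - r != 0 by rewrite subr_eq0.
have := dP (r' - r); rewrite /ball /= sub0r normrN => /(_ r'd r'0).
rewrite -[lim _]/('D_1 u r) uk /= [_%:A](_ : _ = r' - r); last by rewrite /GRing.scale /= mulr1.
rewrite subrK => /ltW h.
have -> : u r' - u r - (r' - r) *: k = - ((r' - r) *: (k - (r' - r)^-1 *: (u r' - u r))).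
  by rewrite scalerBr scalerA mulfV// scale1r opprB.
by rewrite normrN normrZ mulrC ler_wpM2r.
Qed.

Lemma solution_contI g s v u (t : R) : solution g s v u -> contI s t u.
Proof.
move=> [_ cu _]; apply/contI_within; apply: continuous_subspaceW cu.
by move=> x; rewrite /= !in_itv /= => /andP[->].
Qed.

Lemma solution_restart g s v u (r : R) : solution g s v u -> s <= r ->
  solution g r (u r) u.
Proof.
move=> [us cu du] sr; split => //; last by move=> t rt; apply: du; exact: le_lt_trans rt.
apply: continuous_subspaceW cu => x; rewrite /= !in_itv /= !andbT.
exact: le_trans.
Qed.

Lemma contI_affine s t (r0 : R) (k : X) : contI s t (fun r => (r - r0) *: k).
Proof.
move=> r _ _ e e0; exists (e / (`|k| + 1)); first by rewrite divr_gt0// ltr_wpDl.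
move=> r' _ _; rewrite -scalerBl normrZ ltr_pdivlMr ?ltr_wpDl//.
rewrite opprB addrA subrK; apply: le_lt_trans.
by rewrite ler_wpM2l// lerDl.
Qed.

(** The equation holds at the initial time too, with a derivative from the
    right, as the right-hand side is continuous along the solution. *)
Lemma solution_right_derivative g s v u (t : R) : s < t -> solution g s v u ->
  contI s t (fun r => g r (u r)) ->
  forall r, s <= r -> r < t -> forall e : R, 0 < e -> exists2 d : R, 0 < d &
    forall r', r <= r' -> r' < r + d -> r' <= t ->
      `|u r' - u r - (r' - r) *: g r (u r)| <= e * (r' - r).
Proof.
move=> st su cg r sr rt e e0; have e20 : 0 < e / 2 by lra.
have [d d0 dP] := cg r sr (ltW rt) _ e20.
exists d => // r' rr' r'd r't.
pose z q := u q - (q - r) *: g r (u r).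
have -> : u r' - u r - (r' - r) *: g r (u r) = z r' - z r.
  by rewrite /z subrr scale0r subr0 addrAC.
rewrite mulrBr; apply: (@mean_value_majorant _ _ r r' z ( *%R e)) => //.
- apply: contIB; last exact: contI_affine.
  exact/(contI_sub sr r't)/solution_contI/su.
- by move=> p q _ pq _; rewrite ler_pM2l.
move=> q rq qr' k k0; have [_ _ du] := su.
have [d' d'0 d'P] := is_derive_linear_approx (du q (le_lt_trans sr rq)) e20.
exists d' => // q' qq' q'd' q'r'.
have := d'P q' ltac:(rewrite gtr0_norm; lra).
have /ltW : `|g q (u q) - g r (u r)| < e / 2.
  by apply: dP; [lra|lra|rewrite gtr0_norm; lra].
rewrite [`|q' - q|]gtr0_norm ?subr_gt0//.
set gq := g q (u q); set gr := g r (u r) => h1 h2.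
have -> : z q' - z q = (u q' - u q - (q' - q) *: gq) + (q' - q) *: (gq - gr).
  have -> : (q' - q) *: (gq - gr) = (q' - q) *: gq - ((q' - r) *: gr - (q - r) *: gr).
    by rewrite -scalerBl scalerBr; congr (_ - _ *: _); ring.
  by rewrite /z -/gr addrA subrK !opprB addrACA [RHS]addrACA [- u q - _]addrC.
apply: le_trans (ler_normD _ _) _; rewrite normrZ gtr0_norm ?subr_gt0//.
have : (q' - q) * `|gq - gr| <= (q' - q) * (e / 2) by rewrite ler_wpM2l// subr_ge0 ltW.
have : 0 <= k * (q' - q) by rewrite mulr_ge0 ?ltW// subr_gt0.
by lra.
Qed.

End Solutions.

(** * Short-time estimates for Lipschitz fields *)

Lemma sub_interchange (V : zmodType) (x y z t : V) :
  (x - y) - (z - t) = (x - z) - (y - t).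
Proof. by rewrite !opprB addrACA [RHS]addrACA [- y - z]addrC. Qed.

Section Fields.
Context {R : realType} {X : completeNormedModType R}.
Local Notation mu := (@lebesgue_measure R).

Definition family_continuous (A : R -> {linear X -> X}) : Prop :=
  (forall t, 0 <= t -> exists2 K : R, 0 <= K & forall x, `|A t x| <= K * `|x|) /\
  (forall t, 0 <= t -> forall e : R, 0 < e -> exists2 d : R, 0 < d &
     forall r, 0 <= r -> `|r - t| < d -> forall x, `|A r x - A t x| <= e * `|x|).

Definition field_continuous (f : R -> X -> X) : Prop :=
  forall t x, 0 <= t -> forall e : R, 0 < e -> exists2 d : R, 0 < d &
     forall t' x', 0 <= t' -> `|t' - t| < d -> `|x' - x| < d ->
       `|f t' x' - f t x| < e.

(** The clamping at [0] makes the Lipschitz constant a function on the line. *)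
Definition lip_at (f : R -> X -> X) (r : R) : R := Lip (f (Num.max r 0)).

Definition lip_field (f : R -> X -> X) : Prop :=
  forall t, 0 <= t -> [lipschitz f t x | x in setT].

Definition lip_locally_integrable (f : R -> X -> X) : Prop :=
  forall n : R, exists M : R, (\int[mu]_(r in `[0%R, n]) (lip_at f r)%:E <= M%:E)%E.

Lemma lip_atE f r : 0 <= r -> lip_at f r = Lip (f r).
Proof. by move=> r0; rewrite /lip_at max_l. Qed.

Lemma family_locally_bounded A t : family_continuous A -> 0 <= t ->
  exists2 K : R, 0 <= K & exists2 d : R, 0 < d &
    forall r, 0 <= r -> `|r - t| < d -> forall x, `|A r x| <= K * `|x|.
Proof.
move=> [bA cA] t0; have [K K0 KP] := bA t t0.
have [d d0 dP] := cA t t0 1 ltr01.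
exists (1 + K); first by lra.
exists d => // r r0 rt x; rewrite -[A r x](subrK (A t x)) mulrDl.
by rewrite (le_trans (ler_normD _ _))// lerD// dP.
Qed.

Lemma contI_family A s t z : family_continuous A -> 0 <= s -> contI s t z ->
  contI s t (fun r => A r (z r)).
Proof.
move=> hA s0 cz r sr rt e e0; have r0 := le_trans s0 sr.
have [K K0 [d d0 dP]] := family_locally_bounded hA r0.
have K1 : 0 < K + 1 by lra.
have [|d1 d10 d1P] := cz r sr rt (e / 2 / (K + 1)); first by rewrite divr_gt0//; lra.
have z1 : 0 < `|z r| + 1 by rewrite ltr_wpDl.
have [|d2 d20 d2P] := hA.2 r r0 (e / 2 / (`|z r| + 1)).
  by rewrite divr_gt0//; lra.
exists (Num.min d (Num.min d1 d2)); first by rewrite !lt_min d0 d10.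
move=> r' sr' r't; rewrite !lt_min => /and3P[rd rd1 rd2].
have r'0 := le_trans s0 sr'.
have -> : A r' (z r') - A r (z r) = A r' (z r' - z r) + (A r' (z r) - A r (z r)).
  by rewrite linearB addrA subrK.
apply: le_lt_trans (ler_normD _ _) _.
have := dP r' r'0 rd (z r' - z r); have := d2P r' r'0 rd2 (z r).
have := d1P r' sr' r't rd1; rewrite ltr_pdivlMr//.
have : e / 2 / (`|z r| + 1) * `|z r| <= e / 2.
  by rewrite -mulrA ler_piMr ?ler_pdivrMl//; lra.
have := normr_ge0 (z r' - z r).
by nra.
Qed.

Lemma contI_field f s t z : field_continuous f -> 0 <= s -> contI s t z ->
  contI s t (fun r => f r (z r)).
Proof.
move=> cf s0 cz r sr rt e e0; have r0 := le_trans s0 sr.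
have [d d0 dP] := cf r (z r) r0 e e0; have [d1 d10 d1P] := cz r sr rt d d0.
exists (Num.min d d1); first by rewrite lt_min d0.
move=> r' sr' r't; rewrite lt_min => /andP[rd rd1].
by apply: dP => //; [exact: le_trans sr' | exact: d1P].
Qed.

Section Flow.
Variables (A : R -> {linear X -> X}) (f : R -> X -> X).
Hypotheses (hA : family_continuous A) (cf : field_continuous f)
  (lf : lip_field f) (mf : lip_locally_integrable f).
Let G t x := A t x + f t x.

Lemma lip_local_small c : 0 <= c -> forall e : R, 0 < e -> exists2 d : R, 0 < d &
  forall r r' : R, 0 <= r -> c - d < r -> r' < c + d -> r' <= c + 1 ->
    (\int[mu]_(x in `[r, r']) (lip_at f x)%:E <= e%:E)%E.
Proof.
move=> c0 e e0; have [M MP] := mf (c + 1).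
have [||d d0 dP] := integral_local_small _ _ MP c e0.
- exact: measurable_funTS (measurable_Lip lf cf).
- by move=> r; exact: Lip_ge0.
- by exists d => // r r' r0 cr r'c r'c1; apply: dP.
Qed.

(** A Gronwall estimate with the rate [K + lip_at f r], integrable and possibly
    unbounded in time. If [M] bounds the difference of the solutions on a short
    interval, where the rate has mass at most [k], then so does
    [|v - v'| + k * M]. *)
Lemma solution_near_identity c : 0 <= c ->
  forall e : R, 0 < e -> exists2 d : R, 0 < d &
  forall r r' : R, 0 <= r -> c - d < r -> r <= r' -> r' < c + d ->
  forall v v' u u', solution G r v u -> solution G r v' u' ->
    `|(u r' - u' r') - (v - v')| <= e * `|v - v'|.
Proof.
move=> c0 e e0.
pose k := e / (1 + e).
have e1 : 0 < 1 + e by lra.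
have k0 : 0 < k by rewrite divr_gt0.
have k1 : k < 1 by rewrite ltr_pdivrMr//; lra.
have ke : k / (1 - k) = e.
  have k1' : 1 - k != 0 by rewrite gt_eqF//; lra.
  apply: (mulIf k1'); rewrite divfK// /k; field; exact: lt0r_neq0.
have [K K0 [d1 d10 d1P]] := family_locally_bounded hA c0.
have k20 : 0 < k / 2 by lra.
have [d2 d20 d2P] := lip_local_small c0 k20.
have K10 : 0 < K + 1 by lra.
pose d := Num.min (Num.min d1 d2) (Num.min 1 (k / 4 / (K + 1))).
have d0 : 0 < d.
  by rewrite !lt_min d10 d20 ltr01 /= !divr_gt0.
have dd1 : d <= d1 by rewrite !ge_min lexx.
have dd2 : d <= d2 by rewrite !ge_min lexx orbT.
have dd3 : d <= 1 by rewrite !ge_min lexx ?orbT.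
have dd4 : d * (K + 1) <= k / 4 by rewrite -ler_pdivlMr// !ge_min lexx ?orbT.
exists d => // r r' r0 cr rr' r'c v v' u u' su su'.
pose z q := u q - u' q.
have cu : contI r r' u := solution_contI su.
have cu' : contI r r' u' := solution_contI su'.
have cz : contI r r' z by exact: contIB.
have zr : z r = v - v' by rewrite /z; case: su => ->; case: su' => ->.
have near q : r <= q -> q <= r' -> `|q - c| < d1.
  by move=> rq qr'; rewrite ltr_distl; apply/andP; split; lra.
have int_rate q : r <= q -> q <= r' ->
    (\int[mu]_(x in `[r, q]) (K + lip_at f x)%:E <= k%:E)%E.
  move=> rq qr'; under eq_integral do rewrite EFinD.
  have l0 x : `[r, q]%classic x -> (0 <= (lip_at f x)%:E)%E.
    by move=> _; rewrite lee_fin Lip_ge0.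
  have ml : measurable_fun `[r, q] (EFin \o lip_at f).
    by apply/measurable_EFinP; exact: measurable_funTS (measurable_Lip lf cf).
  have K0' x : `[r, q]%classic x -> (0 <= K%:E)%E by rewrite lee_fin.
  rewrite ge0_integralD//.
  rewrite integral_cst//= lebesgue_measure_itv /= lte_fin.
  have -> : ((if (r < q)%R then (q%:E - r%:E)%E else 0%E) = (q - r)%:E)%E.
    by case: ltgtP rq => // -> _; rewrite subrr.
  apply: (@le_trans _ _ ((k / 2)%:E + (k / 2)%:E)%E); last first.
    by rewrite -EFinD lee_fin -splitr.
  apply: leeD; last by apply: d2P => //; lra.
  rewrite -EFinM lee_fin.
  have : K * (q - r) <= (K + 1) * (2 * d) by apply: ler_pM => //; lra.
  by lra.
have bound M : 0 <= M -> (forall q, r <= q -> q <= r' -> `|z q| <= M) ->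
    forall q, r <= q -> q <= r' -> `|z q - z r| <= M * k.
  move=> M0 zM q rq qr'.
  have cGu : contI r r' (fun q => G q (u q)).
    by apply: contID; [exact: contI_family | exact: contI_field].
  have cGu' : contI r r' (fun q => G q (u' q)).
    by apply: contID; [exact: contI_family | exact: contI_field].
  pose h q := `|G q (u q) - G q (u' q)|.
  apply: (@mean_value_domination _ _ r q z h (fun x => K + lip_at f x)) => //.
  - exact: contI_sub cz.
  - by apply: (contI_sub (lexx r) qr'); apply/contI_norm/contIB.
  - by move=> p _ _; exact: normr_ge0.
  - move=> p rp pq w w0; have w20 : 0 < w / 2 by lra.
    have [_ _ du] := su; have [_ _ du'] := su'.
    have [b b0 bP] := is_derive_linear_approx (du p rp) w20.
    have [b' b'0 b'P] := is_derive_linear_approx (du' p rp) w20.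
    exists (Num.min b b'); first by rewrite lt_min b0.
    move=> p' pp'; rewrite -ltrBlDl lt_min => /andP[pb pb'] p'q.
    have ap : `|p' - p| = p' - p by rewrite gtr0_norm// subr_gt0.
    have := bP p'; have := b'P p'; rewrite ap => /(_ pb') h2 /(_ pb) h1.
    have -> : z p' - z p = (p' - p) *: (G p (u p) - G p (u' p)) +
       ((u p' - u p - (p' - p) *: G p (u p)) -
        (u' p' - u' p - (p' - p) *: G p (u' p))).
      by rewrite scalerBr [X in _ = _ + X]sub_interchange [RHS]addrC subrK /z sub_interchange.
    apply: le_trans (ler_normD _ _) _; rewrite normrZ ap [leRHS]mulrC mulrDr lerD2l.
    apply: le_trans (ler_normB _ _) _; lra.
  - move=> p rp pq; have p0 := le_trans r0 rp.
    rewrite /h /G opprD addrACA -linearB.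
    apply: le_trans (ler_normD _ _) _.
    have := d1P p p0 (near p rp (le_trans pq qr')) (u p - u' p).
    have := Lip_bound (u p) (u' p) (lf p0); rewrite -lip_atE//.
    have := zM p rp (le_trans pq qr'); rewrite /z.
    have : 0 <= lip_at f p by exact: Lip_ge0.
    have := normr_ge0 (u p - u' p).
    by nra.
  - exact: int_rate.
have [M0 M00 M0P] := contI_bounded rr' cz.
have improve (w : R) : 0 < w -> exists M, [/\ 0 <= M, M <= `|z r| / (1 - k) + w &
    forall q, r <= q -> q <= r' -> `|z q| <= M].
  apply: (@iterate_improvement _
    (fun M => forall q, r <= q -> q <= r' -> `|z q| <= M) _ _ M0) => //.
    exact: ltW.
  move=> M M1 zM q rq qr'; rewrite -[z q](subrK (z r)) addrC.
  by rewrite (le_trans (ler_normD _ _))// lerD2l mulrC bound.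
rewrite -zr -/(z r') -ke; apply/ler_addgt0Pr => w w0.
have [M [M1 Mle zM]] := improve w w0.
apply: le_trans (bound M M1 zM r' rr' (lexx _)) _.
have -> : k / (1 - k) * `|z r| = `|z r| / (1 - k) * k by ring.
have : M * k <= (`|z r| / (1 - k) + w) * k by rewrite ler_wpM2r// ltW.
have : w * k <= w by rewrite ler_piMr ?ltW.
by rewrite mulrDl; lra.
Qed.

End Flow.
End Fields.

(** * The linear flow *)

Section OperatorNorm.
Context {R : realType} {X : completeNormedModType R}.

Lemma opnorm_bound (L : X -> X) (k : R) :
  (forall (c : R) x, L (c *: x) = c *: L x) -> (opnorm L <= k%:E)%E ->
  forall x, `|L x| <= k * `|x|.
Proof.
move=> LZ Lk x; have [->|x0] := eqVneq x 0.
  by rewrite -(scale0r 0) LZ !scale0r !normr0 mulr0.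
have nx : 0 < `|x| by rewrite normr_gt0.
have : (`|L (`|x|^-1 *: x)|%:E <= k%:E)%E.
  apply: le_trans Lk; apply: ereal_sup_ubound; exists (`|x|^-1 *: x) => //=.
  by rewrite normrZ normfV normr_id mulVf// gt_eqF.
by rewrite lee_fin LZ normrZ normfV normr_id ler_pdivrMl// mulrC.
Qed.

Lemma opnorm_lty_bound (L : X -> X) :
  (forall (c : R) x, L (c *: x) = c *: L x) -> (opnorm L < +oo)%E ->
  exists2 k : R, 0 <= k & forall x, `|L x| <= k * `|x|.
Proof.
move=> LZ Loo; have L0 : L 0 = 0 by rewrite -(scale0r 0) LZ !scale0r.
have op0 : (0 <= opnorm L)%E.
  by apply: ereal_sup_ubound; exists 0; rewrite /= ?normr0 ?L0 ?normr0.
have fop : opnorm L \is a fin_num by rewrite ge0_fin_numE.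
exists (fine (opnorm L)); first exact: fine_ge0.
by apply: opnorm_bound => //; rewrite fineK.
Qed.

End OperatorNorm.

Section LinearFlow.
Context {R : realType} {X : completeNormedModType R}.
Variables (A : R -> {linear X -> X}) (T : R -> R -> X -> X).
Hypotheses (hA : family_continuous A)
  (hT : solution_family (fun t x => A t x) T).
Let lin t x := A t x.

(** The linear equation is the case [f = 0] of [solution_near_identity]. *)
Lemma linear_near_identity c : 0 <= c ->
  forall e : R, 0 < e -> exists2 d : R, 0 < d &
  forall r r' : R, 0 <= r -> c - d < r -> r <= r' -> r' < c + d ->
  forall v v' u u', solution lin r v u -> solution lin r v' u' ->
    `|(u r' - u' r') - (v - v')| <= e * `|v - v'|.
Proof.
have <- : (fun t x => A t x + (fun _ _ => 0) t x) = lin.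
  by apply/funext => t; apply/funext => x; rewrite addr0.
have Lip0 (r : R) : lip_at (fun _ _ : _ => 0 : X) r = 0.
  apply/le_anti; rewrite Lip_ge0 andbT; apply: Lip_le => // x y.
  by rewrite subrr normr0 mul0r.
apply: solution_near_identity => //.
- by move=> t x _ e e0; exists 1 => // *; rewrite addrN normr0.
- move=> t _; apply: (@klipschitzW _ _ _ 0).
    exact: (@globally_properfilter _ _ (0, 0)).
  by move=> [x y] _ /=; rewrite subrr normr0 mul0r.
- move=> n; exists 0; rewrite integral0_eq// => r _.
  by rewrite Lip0.
Qed.

(** Over a short time, solutions that agree at the beginning agree at the end. *)
Lemma linear_unique s v u w : 0 <= s -> solution lin s v u ->
  solution lin s v w -> forall t, s <= t -> u t = w t.
Proof.
move=> s0 su sw t st.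
have : u s = w s by case: su => -> _ _; case: sw => ->.
apply: (@cousin _ (fun r r' => u r = w r -> u r' = w r') s t st).
  by move=> r1 r2 r3 _ _ _ _ h12 h23 /h12 /h23.
move=> c sc ct; have [d d0 dP] := linear_near_identity (le_trans s0 sc) ltr01.
exists d => // r r' sr r't cr rc cr' r'c uw.
have := dP r r' (le_trans s0 sr) cr (le_trans rc cr') r'c _ _ _ _
  (solution_restart su sr) (solution_restart sw sr).
by rewrite uw subrr subr0 normr0 mulr0 normr_le0 subr_eq0 => /eqP.
Qed.

Lemma T_solution s v : 0 <= s -> solution lin s v (fun t => T t s v).
Proof. exact: hT. Qed.

Lemma T_id s v : 0 <= s -> T s s v = v.
Proof. by move=> /(T_solution v) []. Qed.

Lemma T_cocycle t r s v : 0 <= s -> s <= r -> r <= t ->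
  T t r (T r s v) = T t s v.
Proof.
move=> s0 sr rt; have r0 := le_trans s0 sr.
exact: (@linear_unique r (T r s v) (fun t => T t r (T r s v)) (fun t => T t s v)
  r0 (T_solution _ r0) (solution_restart (T_solution v s0) sr) t rt).
Qed.

Lemma T_linear t s (k : R) x y : 0 <= s -> s <= t ->
  T t s (k *: x + y) = k *: T t s x + T t s y.
Proof.
move=> s0 st.
apply: (@linear_unique s (k *: x + y) (fun t => T t s (k *: x + y))
  (fun t => k *: T t s x + T t s y) s0 (T_solution _ s0) _ t st).
have [xs cx dx] := T_solution x s0; have [ys cy dy] := T_solution y s0.
split.
- by rewrite !T_id.
- move/subspace_continuousP : cx => cx; move/subspace_continuousP : cy => cy.
  apply/subspace_continuousP => r sr; apply: cvgD; last exact: cy.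
  by apply: cvgZl_tmp; exact: cx.
- move=> r sr; rewrite /lin linearP.
  have hx := dx r sr; have hy := dy r sr.
  exact: (@is_deriveD _ _ _ (k \*: (fun t => T t s x)) (fun t => T t s y) r 1).
Qed.

Lemma T_sub t s x y : 0 <= s -> s <= t -> T t s (x - y) = T t s x - T t s y.
Proof.
by move=> s0 st; rewrite addrC -scaleN1r T_linear// scaleN1r addrC.
Qed.

Lemma T_zero t s : 0 <= s -> s <= t -> T t s 0 = 0.
Proof. by move=> s0 st; have := T_sub 0 0 s0 st; rewrite !subrr. Qed.

Lemma T_scale t s (k : R) x : 0 <= s -> s <= t -> T t s (k *: x) = k *: T t s x.
Proof. by move=> s0 st; rewrite -[k *: x]addr0 T_linear// T_zero// addr0. Qed.

Lemma T_near_identity c : 0 <= c ->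
  forall e : R, 0 < e -> exists2 d : R, 0 < d &
  forall r r' : R, 0 <= r -> c - d < r -> r <= r' -> r' < c + d ->
  forall v, `|T r' r v - v| <= e * `|v|.
Proof.
move=> c0 e e0; have [d d0 dP] := linear_near_identity c0 e0.
exists d => // r r' r0 cr rr' r'c v.
have := dP r r' r0 cr rr' r'c v 0 _ _ (T_solution v r0) (T_solution 0 r0).
by rewrite T_zero// !subr0.
Qed.

(** Both bounds hold over a short time, where the flow is close to the identity,
    and chain by the cocycle property. The lower one stands for the invertibility
    of the flow. *)
Lemma T_bounds s t : 0 <= s -> s <= t -> exists2 K : R, 1 <= K &
  forall r, s <= r -> r <= t ->
    (forall v, `|T t r v| <= K * `|v|) /\ (forall v, `|v| <= K * `|T r s v|).
Proof.
move=> s0 st; apply: (@cousin _ (fun p q => exists2 K : R, 1 <= K &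
  forall r, p <= r -> r <= q ->
    (forall v, `|T q r v| <= K * `|v|) /\ (forall v, `|v| <= K * `|T r p v|)) s t st).
  move=> r1 r2 r3 sr1 r12 r23 r3t [K1 K11 h1] [K2 K21 h2].
  have r10 := le_trans s0 sr1; have r20 := le_trans r10 r12.
  exists (K1 * K2); first by rewrite -[1]mulr1 ler_pM.
  have [K10 K20] : 0 <= K1 /\ 0 <= K2 by split; lra.
  move=> r r1r rr3; have [rr2|r2r] := leP r r2.
    have [up1 lo1] := h1 r r1r rr2; have [up2 _] := h2 r2 (lexx _) r23.
    split=> v.
      rewrite -(@T_cocycle r3 r2 r)//; last exact: le_trans r1r.
      rewrite [K1 * K2]mulrC -mulrA; apply: le_trans (up2 _) _.
      by rewrite ler_wpM2l.
    apply: le_trans (lo1 v) _; rewrite ler_wpM2r// ler_peMr//.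
  have r2r' := ltW r2r.
  have [up2 lo2] := h2 r r2r' rr3; have [_ lo1] := h1 r2 r12 (lexx _).
  split=> v.
    by apply: le_trans (up2 v) _; rewrite ler_wpM2r// ler_peMl.
  apply: le_trans (lo1 v) _; rewrite -mulrA ler_wpM2l//.
  by apply: le_trans (lo2 _) _; rewrite T_cocycle.
move=> c sc ct; have c0 := le_trans s0 sc.
have e0 : 0 < 1 / 2 :> R by lra.
have [d d0 dP] := T_near_identity c0 e0; exists d => // p q sp qt cp pc cq qc.
exists 2; first by lra.
move=> r pr rq; split=> v.
  have := dP r q (le_trans s0 (le_trans sp pr)) (lt_le_trans cp pr) rq qc v.
  by have := normr_ge0 v; have := lerB_dist (T q r v) v; lra.
have := dP p r (le_trans s0 sp) cp pr (le_lt_trans rq qc) v.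
by have := normr_ge0 v; have := lerB_dist v (T r p v); rewrite distrC; lra.
Qed.

End LinearFlow.

(** * The invariant splitting *)

Section Splitting.
Context {R : realType} {X : completeNormedModType R}.
Variables (A : R -> {linear X -> X}) (T : R -> R -> X -> X)
  (P : R -> {linear X -> X}) (a b : R -> R -> R).
Hypotheses (hA : family_continuous A)
  (hT : solution_family (fun t x => A t x) T) (hP : general_dichotomy T P a b).
Let Q := Q_ P.
Let E := E_ P.
Let F := F_ P.
(* The evolution back from time [t] to time [s] along the unstable spaces. *)
Let B t s x := Tinv T P t s (Q t x).

Lemma P_idem s x : 0 <= s -> P s (P s x) = P s x.
Proof. by move=> s0; have [[h _] _] := hP; have [_] := h s s0; apply. Qed.

Lemma T_P t s x : 0 <= s -> s <= t -> T t s (P s x) = P t (T t s x).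
Proof. by move=> s0 st; have [[_ h] _] := hP; have [] := h t s s0 st. Qed.

Lemma P_Q s x : 0 <= s -> P s (Q s x) = 0.
Proof. by move=> s0; rewrite /Q /Q_ linearB P_idem ?subrr. Qed.

Lemma P_add_Q s x : P s x + Q s x = x.
Proof. by rewrite /Q /Q_ addrC subrK. Qed.

Lemma Q_sub s x y : Q s (x - y) = Q s x - Q s y.
Proof. by rewrite /Q /Q_ linearB sub_interchange. Qed.

Lemma Q_scale s (k : R) x : Q s (k *: x) = k *: Q s x.
Proof. by rewrite /Q /Q_ linearZ scalerBr. Qed.

Lemma Q_F s x : F s x -> Q s x = x.
Proof. by rewrite /F /F_ /Q /Q_ /= => ->; rewrite subr0. Qed.

Lemma F_Q s x : 0 <= s -> F s (Q s x).
Proof. exact: P_Q. Qed.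

Lemma P_E s x : 0 <= s -> E s x -> P s x = x.
Proof. by move=> s0 [y _ <-]; rewrite P_idem. Qed.

Lemma E_P s x : E s (P s x).
Proof. by exists x. Qed.

Lemma P_norm_bound s : 0 <= s -> exists2 k : R, 0 <= k & forall x, `|P s x| <= k * `|x|.
Proof.
move=> s0; have [[h _] _] := hP; have [opP _] := h s s0.
by apply: opnorm_lty_bound => // c x; rewrite linearZ.
Qed.

Lemma T_P_bound t s x : 0 <= s -> s <= t -> `|T t s (P s x)| <= a t s * `|x|.
Proof.
move=> s0 st; have [_ h] := hP; have [ha _] := h t s s0 st.
apply: (opnorm_bound _ ha) => c y.
by rewrite /comp linearZ (T_scale hA hT).
Qed.

Lemma T_Q t s x : 0 <= s -> s <= t -> T t s (Q s x) = Q t (T t s x).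
Proof. by move=> s0 st; rewrite /Q /Q_ (T_sub hA hT)// T_P. Qed.

Lemma T_inj t s x y : 0 <= s -> s <= t -> T t s x = T t s y -> x = y.
Proof.
move=> s0 st Txy; have [K K1 KP] := T_bounds hA hT s0 st.
have [_ lo] := KP t st (lexx t).
apply/eqP; rewrite -subr_eq0 -normr_le0 (le_trans (lo _))//.
by rewrite (T_sub hA hT)// Txy subrr normr0 mulr0.
Qed.

Lemma B_spec t s x : 0 <= s -> s <= t -> F s (B t s x) /\ T t s (B t s x) = Q t x.
Proof.
move=> s0 st; have [[_ h] _] := hP; have [_ imF bijF _] := h t s s0 st.
have t0 := le_trans s0 st.
have FQ : F t (Q t x) by exact: F_Q.
split; first by have [funF _ _] := bijpinv_bij (fun=> 0) bijF; exact: funF.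
by apply: pinvK; rewrite inE imF.
Qed.

(** The flow is injective, so that this characterization yields all the algebraic
    rules for the backward evolution [B]. *)
Lemma B_unique t s x y : 0 <= s -> s <= t -> F s y -> T t s y = Q t x -> B t s x = y.
Proof.
move=> s0 st Fy Ty; have [_ TB] := B_spec x s0 st.
by apply: (T_inj s0 st); rewrite TB Ty.
Qed.

Lemma P_B t s x : 0 <= s -> s <= t -> P s (B t s x) = 0.
Proof. by move=> s0 st; have [] := B_spec x s0 st. Qed.

Lemma T_B t s x : 0 <= s -> s <= t -> T t s (B t s x) = Q t x.
Proof. by move=> s0 st; have [] := B_spec x s0 st. Qed.

Lemma B_sub t s x y : 0 <= s -> s <= t -> B t s (x - y) = B t s x - B t s y.
Proof.
move=> s0 st; apply: B_unique => //.
  by rewrite /F /F_ /= linearB !P_B// subrr.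
by rewrite (T_sub hA hT)// !T_B// Q_sub.
Qed.

Lemma B_scale t s (k : R) x : 0 <= s -> s <= t -> B t s (k *: x) = k *: B t s x.
Proof.
move=> s0 st; apply: B_unique => //.
  by rewrite /F /F_ /= linearZ /= P_B// scaler0.
by rewrite (T_scale hA hT)// !T_B// Q_scale.
Qed.

Lemma B_T t r s x : 0 <= s -> s <= r -> r <= t -> B t s (T t r x) = B r s x.
Proof.
move=> s0 sr rt; have r0 := le_trans s0 sr; apply: B_unique => //.
- exact: le_trans rt.
- exact: P_B.
- by rewrite -(T_cocycle hA hT _ s0 sr rt) T_B// T_Q.
Qed.

Lemma B_id s x : 0 <= s -> B s s x = Q s x.
Proof.
by move=> s0; apply: B_unique => //; [exact: F_Q | rewrite (T_id hT)].
Qed.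

Lemma B_bound t s x : 0 <= s -> s <= t -> `|B t s x| <= b t s * `|x|.
Proof.
move=> s0 st; have [_ h] := hP; have [_ hb] := h t s s0 st.
by apply: (opnorm_bound _ hb) => c y; exact: B_scale.
Qed.

Lemma B_Q t s x : 0 <= s -> s <= t -> B t s (Q t x) = B t s x.
Proof.
by move=> s0 st; rewrite /B Q_F//; apply: F_Q; exact: le_trans st.
Qed.

(** The splitting is invariant under a flow that is close to the identity, so the
    projections depend continuously on time in the operator norm: they are first
    bounded near [c], by comparison with [P c], and then compared pairwise. *)
Lemma P_near c : 0 <= c -> forall e : R, 0 < e -> exists2 d : R, 0 < d &
  forall r r' : R, 0 <= r -> c - d < r -> r <= r' -> r' < c + d ->
    forall v, `|P r' v - P r v| <= e * `|v|.
Proof.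
move=> c0 e e0; have [M0 M00 M0P] := P_norm_bound c0.
have half0 : 0 < 1 / 2 :> R by lra.
have [d1 d10 d1P] := T_near_identity hA hT c0 half0.
pose M := 3 * M0 + 1.
have M1 : 0 < M by rewrite /M; lra.
(* Near [c] the projections are conjugate to [P c] by almost isometric maps. *)
have loc r : 0 <= r -> c - d1 < r -> r < c + d1 -> forall v, `|P r v| <= M * `|v|.
  move=> r0 cr rc v; have [rc'|cr'] := leP r c.
    have h1 := d1P r c r0 cr rc' ltac:(lra).
    have := h1 (P r v); have := h1 v; have := M0P (T c r v).
    rewrite T_P//; have := lerB_dist (P r v) (P c (T c r v)).
    rewrite [`|P r v - _|]distrC; have := lerB_dist (T c r v) v.
    have := normr_ge0 v; have := normr_ge0 (P r v).
    have := normr_ge0 (P c (T c r v)); rewrite /M.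
    move: `|P c (T c r v)| `|T c r v| `|v| `|P r v| => p q w y.
    by move=> p0 y0 w0 h2 h3 h4 h5 h6; nra.
  have cr'' := ltW cr'.
  have [M2 M20 M2P] := P_norm_bound r0.
  have h1 := d1P c r c0 ltac:(lra) (ltW cr') rc.
  have [N [N0 NM NP]] : exists N, [/\ 0 <= N, N <= (3 / 2 * M0) / (1 - 1 / 2) + 1 &
      forall v, `|P r v| <= N * `|v|].
    apply: (@iterate_improvement _ (fun N => forall v, `|P r v| <= N * `|v|) _ _ M2) => //;
      [lra|lra|].
    move=> N N0 NP w.
    have -> : P r w = P r (w - T r c w) + T r c (P c w).
      by rewrite linearB T_P// subrK.
    apply: le_trans (ler_normD _ _) _.
    have := ler_wpM2l N0 (h1 w); rewrite distrC => hN.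
    have := NP (w - T r c w); have := h1 (P c w); have := M0P w.
    have := lerB_dist (T r c (P c w)) (P c w).
    by lra.
  apply: le_trans (NP v) _; rewrite ler_wpM2r//.
  apply: le_trans NM _.
  by have -> : 3 / 2 * M0 / (1 - 1 / 2) = 3 * M0 by field.
have e'0 : 0 < e / (2 * M) by rewrite divr_gt0// mulr_gt0.
have [d2 d20 d2P] := T_near_identity hA hT c0 e'0.
exists (Num.min d1 d2) => [|r r' r0]; first by rewrite lt_min d10.
rewrite ltrBlDr -ltrBlDl lt_min => /andP[cr1 cr2] rr'.
rewrite -ltrBlDl lt_min => /andP[r'c1 r'c2] v.
have r'0 := le_trans r0 rr'.
have -> : P r' v - P r v = P r' (v - T r' r v) + (T r' r (P r v) - P r v).
  by rewrite linearB T_P// addrA subrK.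
apply: le_trans (ler_normD _ _) _.
have h2 := d2P r r' r0 ltac:(lra) rr' ltac:(lra).
have := h2 (P r v); have := loc r' r'0 ltac:(lra) ltac:(lra) (v - T r' r v).
have := ler_wpM2l (ltW M1) (h2 v); rewrite distrC => hM.
have := ler_wpM2l (ltW e'0) (loc r r0 ltac:(lra) ltac:(lra) v).
have {hM} : M * `|v - T r' r v| <= e / 2 * `|v|.
  by apply: le_trans hM _; rewrite le_eqVlt; apply/orP; left; apply/eqP; field;
    exact: lt0r_neq0.
have -> : e / (2 * M) * (M * `|v|) = e / 2 * `|v| by field; exact: lt0r_neq0.
by lra.
Qed.

End Splitting.

(** * Variation of constants *)

Section VariationOfConstants.
Context {R : realType} {X : completeNormedModType R}.
Local Notation mu := (@lebesgue_measure R).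
Variables (A : R -> {linear X -> X}) (T : R -> R -> X -> X) (f : R -> X -> X).
Hypotheses (hA : family_continuous A)
  (hT : solution_family (fun t x => A t x) T) (cf : field_continuous f).
Let G t x := A t x + f t x.

(* [L r] is a family of operators transported by the linear flow, such as
   [T t r \o P r] for [r] below [t], or the backward evolution from [r] to [s]
   along the unstable spaces for [r] above [s]. *)
Variables (s t : R) (L : R -> X -> X) (K : R).
Hypotheses (s0 : 0 <= s) (st : s <= t) (K0 : 0 <= K)
  (L_sub : forall r x y, s <= r -> r <= t -> L r (x - y) = L r x - L r y)
  (L_scale : forall r (k : R) x, s <= r -> r <= t -> L r (k *: x) = k *: L r x)
  (L_bound : forall r x, s <= r -> r <= t -> `|L r x| <= K * `|x|)
  (L_T : forall r r' x, s <= r -> r <= r' -> r' <= t -> L r' (T r' r x) = L r x).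

(** Transport by the flow makes the value at the later time comparable with the
    value at the earlier one, which replaces continuity of [L] itself. *)
Lemma contI_transported z : contI s t z -> contI s t (fun r => L r (z r)).
Proof.
move=> cz r sr rt e e0; have r0 := le_trans s0 sr.
have [M M0 MP] := contI_bounded st cz.
have K1 : 0 < K + 1 by rewrite ltr_wpDl.
have M1 : 0 < M + 1 by lra.
have k0 : 0 < e / 2 / (K + 1) by rewrite !divr_gt0.
have l0 : 0 < e / 2 / (K + 1) / (M + 1) by rewrite divr_gt0.
have [d d0 dP] := cz r sr rt _ k0.
have [d' d'0 d'P] := T_near_identity hA hT r0 l0.
exists (Num.min d d'); first by rewrite lt_min d0.
move=> r' sr' r't; rewrite lt_min => /andP[rd rd'].
(* Compare at the later of the two times. *)
have key p q : s <= p -> p <= q -> q <= t ->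
    `|z q - z p| < e / 2 / (K + 1) ->
    `|T q p (z p) - z p| <= e / 2 / (K + 1) / (M + 1) * `|z p| ->
    `|L q (z q) - L p (z p)| < e.
  move=> sp pq qt hz hT'; rewrite -(L_T (z p) sp pq qt) -L_sub//; last exact: le_trans pq.
  apply: le_lt_trans (L_bound _ (le_trans sp pq) qt) _.
  have hT2 : `|T q p (z p) - z p| <= e / 2 / (K + 1).
    apply: le_trans hT' _; rewrite -[leRHS]mulr1 -mulrA ler_wpM2l ?(ltW k0)//.
    by rewrite mulrC ler_pdivrMr// mul1r; have := MP p sp (le_trans pq qt); lra.
  have : `|z q - T q p (z p)| < e / (K + 1).
    rewrite -[z q](subrK (z p)) -addrA.
    apply: le_lt_trans (ler_normD _ _) _; rewrite [`|z p - _|]distrC.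
    have -> : e / (K + 1) = e / 2 / (K + 1) + e / 2 / (K + 1) by field; exact: lt0r_neq0.
    by rewrite ltr_leD.
  rewrite ltr_pdivlMr// => h; apply: le_lt_trans h.
  by rewrite mulrC ler_wpM2l//; lra.
have [rr'|r'r] := leP r r'.
  apply: key => //; first exact: dP.
  move: rd'; rewrite ltr_distl => /andP[h1 h2].
  by apply: d'P => //; lra.
rewrite distrC; apply: key => //; first exact: ltW.
  by rewrite distrC; exact: dP.
move: rd'; rewrite ltr_distl => /andP[h1 h2].
by apply: d'P => //; [exact: le_trans sr' | lra | lra].
Qed.

(** Transport by [L] cancels the linear part of the equation: over a short time
    [L r (u r - u' r)] changes by [L r (f r (u r) - f r (u' r))] times the
    duration, up to first order. *)
Lemma variation_of_constants v v' u u' (g : R -> R) (c M : R) :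
  solution G s v u -> solution G s v' u' -> 0 <= c ->
  (forall r, s <= r -> r <= t ->
     `|L r (f r (u r) - f r (u' r))| <= c * g r) ->
  (\int[mu]_(r in `[s, t]) (g r)%:E <= M%:E)%E ->
  `|L t (u t - u' t) - L s (u s - u' s)| <= c * M.
Proof.
move=> su su' c0 hg gM.
have cu : contI s t u := solution_contI su.
have cu' : contI s t u' := solution_contI su'.
have cG w : contI s t w -> contI s t (fun r => G r (w r)).
  by move=> cw; apply: contID; [exact: contI_family | exact: contI_field].
pose D r := u r - u' r.
pose k r := f r (u r) - f r (u' r).
have ck : contI s t k by apply: contIB; exact: contI_field.
apply: (@mean_value_domination _ _ s t (fun r => L r (D r))
  (fun r => `|L r (k r)|) g) => //.
- by apply: contI_transported; exact: contIB.
- by apply/contI_norm/contI_transported.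
move=> r sr rt e e0.
have st' : s < t by exact: lt_trans rt.
have K1 : 0 < K + 1 by rewrite ltr_wpDl.
have e10 : 0 < e / 6 / (K + 1) by rewrite !divr_gt0.
have e20 : 0 < e / 2 / (K + 1) / (`|k r| + 1) by rewrite !divr_gt0// ltr_wpDl.
have [sr' rt'] := (ltW sr, ltW rt).
have r0 := le_trans s0 sr'.
have [d1 d10 d1P] := solution_right_derivative st' su (cG u cu) sr' rt e10.
have [d2 d20 d2P] := solution_right_derivative st' su' (cG u' cu') sr' rt e10.
have sT := T_solution hT (D r) r0.
have cT : contI r t (fun q => A q (T q r (D r))).
  by apply: contI_family => //; exact: (solution_contI sT).
have [d3 d30 d3P] := solution_right_derivative rt sT cT (lexx r) rt e10.
have [d4 d40 d4P] := T_near_identity hA hT r0 e20.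
exists (Num.min (Num.min d1 d2) (Num.min d3 d4)); first by rewrite !lt_min d10 d20 d30.
move=> r' rr'; rewrite -ltrBlDl !lt_min -andbA => /and4P[h1 h2 h3 h4] r't.
have rr'' := ltW rr'; have sr'' := le_trans sr' rr''.
have := d1P r' rr'' ltac:(lra) r't; have := d2P r' rr'' ltac:(lra) r't.
have := d3P r' rr'' ltac:(lra) r't; rewrite (T_id hT)//.
set y1 := u r' - _ - _; set y2 := u' r' - _ - _; set y3 := T r' r _ - _ - _.
move=> b3 b2 b1.
have GB : G r (u r) - G r (u' r) = A r (D r) + k r.
  by rewrite /G opprD addrACA -linearB.
have yE : y1 - y2 - y3 = (D r' - T r' r (D r)) - (r' - r) *: k r.
  rewrite /y1 /y2 /y3 [X in X - _]sub_interchange [X in X - _ - _]sub_interchange.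
  rewrite -/(D r') -/(D r) -scalerBr GB sub_interchange -scalerBr.
  by rewrite [A r _ + _]addrC addrK [- (T _ _ _ - _)]opprB addrA subrK.
have -> : L r' (D r') - L r (D r) =
    L r' (y1 - y2 - y3) + (r' - r) *: (L r' (k r - T r' r (k r)) + L r (k r)).
  rewrite [L r' (k r - _)]L_sub// L_T// subrK -L_scale// yE [L r' (_ - (r' - r) *: _)]L_sub//.
  by rewrite subrK [L r' (_ - T _ _ _)]L_sub// L_T.
apply: le_trans (ler_normD _ _) _; rewrite normrZ gtr0_norm ?subr_gt0//.
have hy : `|L r' (y1 - y2 - y3)| <= e / 2 * (r' - r).
  apply: le_trans (L_bound _ sr'' r't) _.
  have : `|y1 - y2 - y3| <= 3 * (e / 6 / (K + 1) * (r' - r)).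
    apply: le_trans (ler_normB _ _) _.
    by have := ler_normB y1 y2; lra.
  move=> /(ler_wpM2l K0) /le_trans; apply.
  have -> : K * (3 * (e / 6 / (K + 1) * (r' - r))) = (K / (K + 1)) * (e / 2 * (r' - r)).
    by field; exact: lt0r_neq0.
  rewrite ler_piMl ?mulr_ge0 ?subr_ge0//; first by lra.
  by rewrite ler_pdivrMr//; lra.
have hk : `|L r' (k r - T r' r (k r))| <= e / 2.
  apply: le_trans (L_bound _ sr'' r't) _; rewrite distrC.
  have := d4P r r' r0 ltac:(lra) rr'' ltac:(lra) (k r).
  move=> /(ler_wpM2l K0) /le_trans; apply.
  have kn : 0 < `|k r| + 1 by rewrite ltr_wpDl.
  have -> : K * (e / 2 / (K + 1) / (`|k r| + 1) * `|k r|) =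
      (K / (K + 1)) * ((`|k r| / (`|k r| + 1)) * (e / 2)).
    by field; rewrite !lt0r_neq0.
  have h5 : `|k r| / (`|k r| + 1) <= 1 by rewrite ler_pdivrMr//; lra.
  have h6 : K / (K + 1) <= 1 by rewrite ler_pdivrMr//; lra.
  apply: le_trans (_ : `|k r| / (`|k r| + 1) * (e / 2) <= _).
    have h7 : 0 <= `|k r| / (`|k r| + 1) by rewrite divr_ge0// ltW.
    have h8 : 0 <= e / 2 by lra.
    exact: ler_piMl (mulr_ge0 h7 h8) h6.
  by rewrite ler_piMl//; lra.
have hs := ler_normD (L r' (k r - T r' r (k r))) (L r (k r)).
have r'r0 : 0 <= r' - r by lra.
have := ler_wpM2l r'r0 (le_trans hs (lerD hk (lexx _))).
by move: hy; lra.
Qed.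

End VariationOfConstants.

(** * A priori estimates from the dichotomy *)

Section Dichotomy.
Context {R : realType} {X : completeNormedModType R}.
Local Notation mu := (@lebesgue_measure R).
Variables (A : R -> {linear X -> X}) (T : R -> R -> X -> X)
  (P : R -> {linear X -> X}) (a b : R -> R -> R) (f : R -> X -> X).
Hypotheses (hA : family_continuous A)
  (hT : solution_family (fun t x => A t x) T)
  (ha : forall t s, 0 <= s -> s <= t -> 0 < a t s)
  (hb : forall t s, 0 <= s -> s <= t -> 0 < b t s)
  (hP : general_dichotomy T P a b)
  (cf : field_continuous f) (lf : lip_field f).
Let G t x := A t x + f t x.
Let Q := Q_ P.

Lemma P_bounded s t : 0 <= s -> s <= t -> exists2 M : R, 0 <= M &
  forall r v, s <= r -> r <= t -> `|P r v| <= M * `|v|.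
Proof.
move=> s0 st; apply: (@cousin _ (fun p q => exists2 M : R, 0 <= M &
  forall r v, p <= r -> r <= q -> `|P r v| <= M * `|v|) s t st).
  move=> r1 r2 r3 _ _ _ _ [M1 M10 h1] [M2 M20 h2].
  exists (M1 + M2) => [|r v r1r rr3]; first exact: addr_ge0.
  rewrite mulrDl; have [rr2|/ltW r2r] := leP r r2.
    by apply: le_trans (h1 r v r1r rr2) _; rewrite lerDl mulr_ge0.
  by apply: le_trans (h2 r v r2r rr3) _; rewrite lerDr mulr_ge0.
move=> c sc ct; have c0 := le_trans s0 sc.
have [d d0 dP] := P_near hA hT hP c0 ltr01.
have [M M0 MP] := P_norm_bound hP c0.
exists d => // p q sp qt cp pc cq qc; exists (M + 1); first exact: addr_ge0.
move=> r v pr rq; have r0 : 0 <= r by rewrite (le_trans s0)// (le_trans sp).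
rewrite mulrDl -(subrK (P c v) (P r v)) addrC.
apply: le_trans (ler_normD _ _) _; apply: lerD; first exact: MP.
have [rc|cr] := leP r c.
  rewrite distrC; apply: dP => //; first exact: lt_le_trans pr.
  by rewrite ltrDl.
apply: dP => //; [|exact: ltW|exact: le_lt_trans qc].
by rewrite ltrBlDr ltrDl.
Qed.

(** [variation_of_constants] for the linear flow to time [t] after the projection
    on the stable spaces. The integrand is kept as a function [h], because its
    continuity is needed to pass to the limit under the integral. *)
Lemma stable_integrand s t v v' u u' : 0 <= s -> s <= t ->
  solution G s v u -> solution G s v' u' ->
  exists h : R -> R, [/\ contI s t h, (forall r, 0 <= h r),
    (forall r, s <= r -> r <= t -> h r <= a t r * (Lip (f r) * `|u r - u' r|)) &
    forall M : R, (\int[mu]_(r in `[s, t]) (h r)%:E <= M%:E)%E ->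
      `|P t (u t - u' t)| <= a t s * `|P s (v - v')| + M].
Proof.
move=> s0 st su su'.
have [K1 K11 K1P] := T_bounds hA hT s0 st.
have [K2 K20 K2P] := P_bounded s0 st.
have K0 : 0 <= K1 * K2 by rewrite mulr_ge0// (le_trans ler01).
have pos r : s <= r -> 0 <= r by exact: le_trans.
pose L t r x := T t r (P r x).
have L_sub r x y : s <= r -> r <= t -> L t r (x - y) = L t r x - L t r y.
  by move=> sr rt; rewrite /L linearB (T_sub hA hT)// pos.
have L_scale r (k : R) x : s <= r -> r <= t -> L t r (k *: x) = k *: L t r x.
  by move=> sr rt; rewrite /L linearZ (T_scale hA hT)// pos.
have L_bound r x : s <= r -> r <= t -> `|L t r x| <= K1 * K2 * `|x|.
  move=> sr rt; have [up _] := K1P r sr rt; apply: le_trans (up _) _.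
  by rewrite -mulrA ler_wpM2l ?(le_trans ler01)//; exact: K2P.
have L_T r r' x : s <= r -> r <= r' -> r' <= t -> L t r' (T r' r x) = L t r x.
  move=> sr rr' r't.
  by rewrite /L -(T_P hP)// ?pos// (T_cocycle hA hT)// pos.
have cu : contI s t u := solution_contI su.
have cu' : contI s t u' := solution_contI su'.
exists (fun r => `|L t r (f r (u r) - f r (u' r))|); split => //.
- apply/contI_norm/(contI_transported hA hT s0 st K0 L_sub L_bound L_T).
  by apply: contIB; exact: contI_field.
- move=> r sr rt; apply: le_trans (T_P_bound hA hT hP _ (pos r sr) rt) _.
  by rewrite ler_wpM2l ?(ltW (ha _ _))// ?pos// Lip_bound//; exact/lf/pos.
move=> M hM.
have := @variation_of_constants _ _ A T f hA hT cf s t (L t) (K1 * K2) s0 st K0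
  L_sub L_scale L_bound L_T v v' u u' _ 1 M su su' ler01 _ hM.
rewrite mul1r /L (T_id hT) ?pos// => h.
have {h} : `|P t (u t - u' t) - T t s (P s (v - v'))| <= M.
  have [us _ _] := su; have [u's _ _] := su'; rewrite -us -u's.
  by apply: h => r _ _; rewrite mul1r.
move=> h; rewrite -[P t _](subrK (T t s (P s (v - v')))) addrC.
apply: le_trans (ler_normD _ _) _; apply: lerD => //.
by rewrite -{1}(P_idem hP _ s0) (T_P_bound hA hT hP).
Qed.

(** The same for the backward evolution to time [s] along the unstable spaces. *)
Lemma unstable_integrand s t v v' u u' : 0 <= s -> s <= t ->
  solution G s v u -> solution G s v' u' ->
  exists h : R -> R, [/\ contI s t h, (forall r, 0 <= h r),
    (forall r, s <= r -> r <= t -> h r <= b r s * (Lip (f r) * `|u r - u' r|)) &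
    forall M : R, (\int[mu]_(r in `[s, t]) (h r)%:E <= M%:E)%E ->
      `|Q s (v - v')| <= b t s * `|Q t (u t - u' t)| + M].
Proof.
move=> s0 st su su'.
have [K1 K11 K1P] := T_bounds hA hT s0 st.
have [K2 K20 K2P] := P_bounded s0 st.
have K10 : 0 <= K1 by exact: le_trans K11.
have K0 : 0 <= K1 * (1 + K2) by rewrite mulr_ge0// addr_ge0.
have pos r : s <= r -> 0 <= r by exact: le_trans.
pose B r x := Tinv T P r s (Q r x).
have B_sub' r x y : s <= r -> r <= t -> B r (x - y) = B r x - B r y.
  by move=> sr rt; exact: (B_sub hA hT hP).
have B_scale' r (k : R) x : s <= r -> r <= t -> B r (k *: x) = k *: B r x.
  by move=> sr rt; exact: (B_scale hA hT hP).
have B_bound' r x : s <= r -> r <= t -> `|B r x| <= K1 * (1 + K2) * `|x|.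
  move=> sr rt; have [_ lo] := K1P r sr rt; apply: le_trans (lo _) _.
  rewrite -mulrA ler_wpM2l// (T_B hP)// mulrDl mul1r.
  by apply: le_trans (ler_normB _ _) _; rewrite lerD2l K2P.
have B_T' r r' x : s <= r -> r <= r' -> r' <= t -> B r' (T r' r x) = B r x.
  by move=> sr rr' r't; exact: (B_T hA hT hP).
have cu : contI s t u := solution_contI su.
have cu' : contI s t u' := solution_contI su'.
exists (fun r => `|B r (f r (u r) - f r (u' r))|); split => //.
- apply/contI_norm/(contI_transported hA hT s0 st K0 B_sub' B_bound' B_T').
  by apply: contIB; exact: contI_field.
- move=> r sr rt; apply: le_trans (B_bound hA hT hP _ s0 sr) _.
  by rewrite ler_wpM2l ?(ltW (hb _ _))// Lip_bound//; exact/lf/pos.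
move=> M hM.
have := @variation_of_constants _ _ A T f hA hT cf s t B (K1 * (1 + K2)) s0 st K0
  B_sub' B_scale' B_bound' B_T' v v' u u' _ 1 M su su' ler01 _ hM.
rewrite mul1r => h.
have {h} : `|B t (u t - u' t) - Q s (v - v')| <= M.
  have [us _ _] := su; have [u's _ _] := su'; rewrite -us -u's.
  rewrite -[Q s (u s - _)](B_id hA hT hP (u s - u' s) s0).
  by apply: h => r _ _; rewrite mul1r.
move=> h; rewrite -[Q s _](subKr (B t (u t - u' t))).
apply: le_trans (ler_normB _ _) _; apply: lerD => //.
by rewrite /B -(B_Q hP _ s0 st) (B_bound hA hT hP).
Qed.

Lemma stable_estimate s t v v' u u' (g : R -> R) (c M : R) :
  0 <= s -> s <= t -> solution G s v u -> solution G s v' u' -> 0 <= c ->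
  (forall r, s <= r -> r <= t ->
     a t r * (Lip (f r) * `|u r - u' r|) <= c * g r) ->
  (\int[mu]_(r in `[s, t]) (g r)%:E <= M%:E)%E ->
  `|P t (u t - u' t)| <= a t s * `|P s (v - v')| + c * M.
Proof.
move=> s0 st su su' c0 hg gM.
have [h [ch h0 hle]] := stable_integrand s0 st su su'; apply.
apply: integral_domination gM => //; first exact: contI_measurable.
move=> r; rewrite /= in_itv /= => /andP[sr rt].
exact: le_trans (hle r sr rt) (hg r sr rt).
Qed.

Lemma unstable_estimate s t v v' u u' (g : R -> R) (c M : R) :
  0 <= s -> s <= t -> solution G s v u -> solution G s v' u' -> 0 <= c ->
  (forall r, s <= r -> r <= t ->
     b r s * (Lip (f r) * `|u r - u' r|) <= c * g r) ->
  (\int[mu]_(r in `[s, t]) (g r)%:E <= M%:E)%E ->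
  `|Q s (v - v')| <= b t s * `|Q t (u t - u' t)| + c * M.
Proof.
move=> s0 st su su' c0 hg gM.
have [h [ch h0 hle]] := unstable_integrand s0 st su su'; apply.
apply: integral_domination gM => //; first exact: contI_measurable.
move=> r; rewrite /= in_itv /= => /andP[sr rt].
exact: le_trans (hle r sr rt) (hg r sr rt).
Qed.

Section APriori.
Variables (al be : R).
Hypotheses (al0 : 0 <= al) (be0 : 0 <= be) (al1 : 2 * al < 1)
  (hal : forall t s, 0 <= s -> s <= t ->
     (\int[mu]_(r in `[s, t]) (a t r * a r s * Lip (f r))%:E <= (al * a t s)%:E)%E)
  (hbe : forall s, 0 <= s ->
     (\int[mu]_(r in `[s, +oo[) (b r s * a r s * Lip (f r))%:E <= be%:E)%E)
  (nz : exists2 z, z != 0 & E_ P 0 z).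
Let C := (1 - 2 * al)^-1.

Lemma unstable_integral_segment s n : 0 <= s ->
  (\int[mu]_(r in `[s, n]) (b r s * a r s * Lip (f r))%:E <= be%:E)%E.
Proof.
move=> s0; apply: le_trans (hbe s0).
have g0 r : s <= r -> (0 <= (b r s * a r s * Lip (f r))%:E)%E.
  by move=> sr; rewrite lee_fin !mulr_ge0 ?Lip_ge0// ltW// (ha, hb).
apply: le_integral_subset_nomeas => //.
- by move=> r; rewrite /= !in_itv /= => /andP[-> _].
- by move=> r; rewrite /= in_itv /= => /andP[sr _]; exact: g0.
- by move=> r; rewrite /= in_itv /= => /andP[sr _]; exact: g0.
Qed.

(** As a nonzero solution of the linear equation does not vanish, [a] is bounded
    below on compact intervals. This makes the a priori bounds relative to [a] finite. *)
Lemma a_lower_bound s t : 0 <= s -> s <= t -> exists2 m : R, 0 < m &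
  forall r, s <= r -> r <= t -> m <= a r s.
Proof.
move=> s0 st; have [z z0 Ez] := nz.
have [K1 K11 K1P] := T_bounds hA hT s0 st.
have K10 : 0 < K1 by exact: lt_le_trans K11.
exists K1^-1 => [|r sr rt]; first by rewrite invr_gt0.
pose y := T s 0 z.
have Py : P s y = y by rewrite /y -(T_P hP)// (P_E hP _ Ez).
have y0 : 0 < `|y|.
  rewrite normr_gt0; apply: contra_neq z0 => y0.
  apply: (T_inj hA hT (lexx 0) s0).
  by rewrite -/y y0 (T_zero hA hT).
have [_ lo] := K1P r sr rt.
have := T_P_bound hA hT hP y s0 sr; rewrite Py => h.
rewrite -(ler_pM2r y0); apply: le_trans h.
by rewrite ler_pdivrMl.
Qed.

(** In the cone, the difference of the solutions is at most twice its stable part.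
    A bound [M * a t s] on the latter then improves to
    [(|P s (v - v')| + 2 * al * M) * a t s]; a first bound exists by
    compactness. *)
Lemma stable_decay s t0 v v' u u' : 0 <= s -> s <= t0 ->
  solution G s v u -> solution G s v' u' ->
  (forall r, s <= r -> r <= t0 ->
     `|u r - u' r| <= 2 * `|P r (u r - u' r)|) ->
  forall t, s <= t -> t <= t0 ->
    `|P t (u t - u' t)| <= C * a t s * `|P s (v - v')|.
Proof.
move=> s0 st0 su su' cone.
have C0 : 0 < 1 - 2 * al by rewrite subr_gt0.
have pos r : s <= r -> 0 <= r by exact: le_trans.
suff improve (w : R) : 0 < w -> exists M, [/\ 0 <= M,
    M <= `|P s (v - v')| / (1 - 2 * al) + w &
    forall t, s <= t -> t <= t0 -> `|P t (u t - u' t)| <= M * a t s].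
  move=> t st tt0; have a0 := ha s0 st.
  rewrite mulrAC -ler_pdivrMr//; apply/ler_addgt0Pr => w w0.
  have [M [M0 Mle hM]] := improve w w0.
  rewrite ler_pdivrMr//; apply: le_trans (hM t st tt0) _.
  by rewrite ler_wpM2r ?(ltW a0)// /C mulrC.
have [m m0 mP] := a_lower_bound s0 st0.
have [K K0 KP] := P_bounded s0 st0.
have cz : contI s t0 (fun r => u r - u' r).
  by apply: contIB; [exact: solution_contI su | exact: solution_contI su'].
have [Z Z0 ZP] := contI_bounded st0 cz.
move=> w0; apply: (@iterate_improvement _ (fun M => forall t, s <= t -> t <= t0 ->
  `|P t (u t - u' t)| <= M * a t s) _ _ (K * Z / m)) => //.
- by rewrite mulr_ge0.
- by rewrite divr_ge0 ?mulr_ge0// ltW.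
- move=> t st tt0; apply: le_trans (KP _ _ st tt0) _.
  apply: le_trans (_ : K * Z <= _); first by rewrite ler_wpM2l// ZP.
  by rewrite -mulrA ler_peMr ?mulr_ge0// ler_pdivlMl// mulr1 mP.
move=> M M0 hM t st tt0; rewrite mulrDl [`|P s _| * _]mulrC.
have -> : 2 * al * M * a t s = (2 * M) * (al * a t s) by ring.
apply: (stable_estimate s0 st su su' _ _ (hal s0 st)); first by rewrite mulr_ge0.
move=> r sr rt; have r0 := pos r sr.
have -> : 2 * M * (a t r * a r s * Lip (f r)) =
          a t r * (Lip (f r) * (2 * (M * a r s))) by ring.
rewrite ler_wpM2l ?(ltW (ha _ _))// ler_wpM2l ?Lip_ge0//.
apply: le_trans (cone r sr (le_trans rt tt0)) _.
by rewrite ler_wpM2l// hM// (le_trans rt).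
Qed.

(** In the cone, the whole difference decays with its stable part, which makes the
    integral over the unstable directions converge with the constant [be]. *)
Lemma unstable_slaving s n v v' u u' : 0 <= s -> s <= n ->
  solution G s v u -> solution G s v' u' ->
  (forall r, s <= r -> r <= n -> `|u r - u' r| <= 2 * `|P r (u r - u' r)|) ->
  `|Q s (v - v')| <= b n s * `|Q n (u n - u' n)| + 2 * C * be * `|P s (v - v')|.
Proof.
move=> s0 sn su su' cone.
have C0 : 0 <= C by rewrite invr_ge0 ltW// subr_gt0.
have -> : 2 * C * be * `|P s (v - v')| = (2 * C * `|P s (v - v')|) * be by ring.
apply: (unstable_estimate s0 sn su su' _ _ (unstable_integral_segment n s0)).
  by rewrite !mulr_ge0.
move=> r sr rn; have r0 := le_trans s0 sr.
have -> : 2 * C * `|P s (v - v')| * (b r s * a r s * Lip (f r)) =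
          b r s * (Lip (f r) * (2 * (C * a r s * `|P s (v - v')|))) by ring.
rewrite ler_wpM2l ?(ltW (hb _ _))// ler_wpM2l ?Lip_ge0//.
apply: le_trans (cone r sr rn) _.
by rewrite ler_wpM2l// (stable_decay s0 sn su su' cone).
Qed.

(** For a stable vector, [a n r * a r 0] is at least the growth of the linear flow
    from [0] to [n], whatever the intermediate time [r]: the integrand of [alpha]
    dominates a positive multiple of the Lipschitz constant. *)
Lemma dichotomy_lip_locally_integrable : lip_locally_integrable f.
Proof.
move=> n; have [n0|n0] := ltP n 0.
  exists 0; rewrite set_itv_ge ?integral_set0//.
  by rewrite bnd_simp -ltNge.
have [z z0 Ez] := nz; have Pz : P 0 z = z by rewrite (P_E hP _ Ez).
pose y r := T r 0 z.
have Py r : 0 <= r -> P r (y r) = y r by move=> r0; rewrite /y -(T_P hP)// Pz.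
have yn : 0 < `|y n|.
  rewrite normr_gt0; apply: contra_neq z0 => y0.
  by apply: (T_inj hA hT (lexx 0) n0); rewrite -/(y n) y0 (T_zero hA hT).
have z1 : 0 < `|z| by rewrite normr_gt0.
exists (`|z| / `|y n| * (al * a n 0)).
have h := hal (lexx 0) n0.
apply: integral_domination h => //.
- exact: measurable_funTS (measurable_Lip lf cf).
- by move=> r _; exact: Lip_ge0.
move=> r; rewrite /= in_itv /= => /andP[r0 rn].
rewrite lip_atE// mulrA ler_peMl ?Lip_ge0//.
rewrite mulrAC ler_pdivlMr// mul1r.
have := T_P_bound hA hT hP (y r) r0 rn; rewrite Py// (T_cocycle hA hT)// -/(y n) => h1.
apply: le_trans h1 _; rewrite [leRHS]mulrC -mulrA ler_wpM2l ?(ltW (ha _ _))//.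
by have := T_P_bound hA hT hP z (lexx 0) r0; rewrite Pz.
Qed.

End APriori.
End Dichotomy.

(** * Pulling back the stable spaces along the nonlinear flow *)

Lemma contraction_fixed_point (R : realType) (X : completeNormedModType R)
    (Z : set X) (N : X -> X) (q : R) :
  closed Z -> Z !=set0 -> (forall x, Z x -> Z (N x)) -> 0 <= q -> q < 1 ->
  (forall x y, Z x -> Z y -> `|N x - N y| <= q * `|x - y|) ->
  exists2 x, Z x & x = N x.
Proof.
move=> cZ Z0 ZN q0 q1 lN.
pose g : {fun Z >-> Z} := HB.pack N (isFun.Build _ _ Z Z N ZN).
apply: (@banach_fixed_point R X Z g _ cZ Z0).
exists (NngNum q0); split => // -[x y] [/= Zx Zy].
exact: lN.
Qed.

Section PullBack.
Context {R : realType} {X : completeNormedModType R}.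
Local Notation mu := (@lebesgue_measure R).
Variables (A : R -> {linear X -> X}) (T : R -> R -> X -> X)
  (P : R -> {linear X -> X}) (a b : R -> R -> R) (f : R -> X -> X)
  (U : R -> R -> X -> X).
Hypotheses (hA : family_continuous A)
  (hT : solution_family (fun t x => A t x) T)
  (ha : forall t s, 0 <= s -> s <= t -> 0 < a t s)
  (hb : forall t s, 0 <= s -> s <= t -> 0 < b t s)
  (hP : general_dichotomy T P a b)
  (cf : field_continuous f) (lf : lip_field f)
  (f0 : forall t, 0 <= t -> f t 0 = 0)
  (hU : solution_family (fun t x => A t x + f t x) U)
  (uU : unique_solutions (fun t x => A t x + f t x))
  (mf : lip_locally_integrable f).
Let G t x := A t x + f t x.
Let Q := Q_ P.
Let E := E_ P.

Lemma U_solution s v : 0 <= s -> solution G s v (fun t => U t s v).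
Proof. exact: hU. Qed.

Lemma U_id s v : 0 <= s -> U s s v = v.
Proof. by move=> /(U_solution v) []. Qed.

Lemma U_cocycle t r s v : 0 <= s -> s <= r -> r <= t ->
  U t r (U r s v) = U t s v.
Proof.
move=> s0 sr rt; have r0 := le_trans s0 sr.
exact: (uU r0 (U_solution _ r0) (solution_restart (U_solution v s0) sr) rt).
Qed.

Lemma U_zero t s : 0 <= s -> s <= t -> U t s 0 = 0.
Proof.
move=> s0 st; apply: (uU s0 (U_solution 0 s0) (w := fun=> 0) _ st); split => //.
  by move=> r; exact: cst_continuous.
move=> r sr; rewrite linear0 f0 ?addr0; last exact: le_trans (ltW sr).
exact: is_derive_cst.
Qed.

Lemma U_near_identity c : 0 <= c -> forall e : R, 0 < e ->
  exists2 d : R, 0 < d &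
  forall r r' : R, 0 <= r -> c - d < r -> r <= r' -> r' < c + d ->
  forall v v', `|(U r' r v - U r' r v') - (v - v')| <= e * `|v - v'|.
Proof.
move=> c0 e e0; have [d d0 dP] := solution_near_identity hA cf lf mf c0 e0.
exists d => // r r' r0 cr rr' r'c v v'.
exact: (dP r r' r0 cr rr' r'c v v' _ _ (U_solution v r0) (U_solution v' r0)).
Qed.

Lemma U_lipschitz s t : 0 <= s -> s <= t -> exists2 K : R, 0 <= K &
  forall v v', `|U t s v - U t s v'| <= K * `|v - v'|.
Proof.
move=> s0 st; apply: (@cousin _ (fun p q => exists2 K : R, 0 <= K &
  forall v v', `|U q p v - U q p v'| <= K * `|v - v'|) s t st).
  move=> r1 r2 r3 sr1 r12 r23 _ [K1 K10 h1] [K2 K20 h2].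
  have r10 := le_trans s0 sr1.
  exists (K2 * K1) => [|v v']; first exact: mulr_ge0.
  rewrite -!(U_cocycle _ r10 r12 r23); apply: le_trans (h2 _ _) _.
  by rewrite -mulrA ler_wpM2l.
move=> c sc ct; have [d d0 dP] := U_near_identity (le_trans s0 sc) ltr01.
exists d => // p q sp qt cp pc cq qc; exists 2 => // v v'.
have := dP p q (le_trans s0 sp) cp (le_trans pc cq) qc v v'.
by have := lerB_dist (U q p v - U q p v') (v - v'); lra.
Qed.

Definition pullback (n r : R) : set X := [set v | Q n (U n r v) = 0].

Definition cone_condition (n r : R) : Prop := forall v v',
  pullback n r v -> pullback n r v' -> `|Q r (v - v')| <= `|P r (v - v')|.

Definition is_lipschitz_graph (n r : R) : Prop := cone_condition n r /\
  (forall xi, E r xi -> exists2 v, pullback n r v & P r v = xi).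

Lemma pullback_flow n t r v : 0 <= r -> r <= t -> t <= n ->
  pullback n r v -> pullback n t (U t r v).
Proof. by move=> r0 rt tn; rewrite /pullback /= U_cocycle. Qed.

Lemma pullback_flow_inv n t r v : 0 <= r -> r <= t -> t <= n ->
  pullback n t (U t r v) -> pullback n r v.
Proof. by move=> r0 rt tn; rewrite /pullback /= U_cocycle. Qed.

Lemma Q_add q x y : Q q (x + y) = Q q x + Q q y.
Proof. by rewrite /Q /Q_ linearD opprD addrACA. Qed.

Lemma norm_le_PQ r v : `|v| <= `|P r v| + `|Q r v|.
Proof. by rewrite -{1}(P_add_Q P r v) ler_normD. Qed.

Lemma cone_eq n r v v' : cone_condition n r -> pullback n r v ->
  pullback n r v' -> P r v = P r v' -> v = v'.
Proof.
move=> cone Wv Wv' Pvv'; apply/eqP; rewrite -subr_eq0 -normr_le0.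
apply: le_trans (norm_le_PQ r _) _; have := cone _ _ Wv Wv'.
by rewrite linearB Pvv' subrr normr0 add0r.
Qed.

Lemma lipschitz_graph_end n : 0 <= n -> is_lipschitz_graph n n.
Proof.
move=> n0; split=> [v v'|xi Exi].
  rewrite /pullback /= !U_id// => Qv Qv'.
  by rewrite /Q Q_sub -/Q Qv Qv' subrr normr0.
have Pxi := P_E hP n0 Exi; exists xi => //.
by rewrite /pullback /= U_id// /Q /Q_ Pxi subrr.
Qed.

Lemma P_closed_fiber r xi : 0 <= r -> closed [set v | P r v = xi].
Proof.
move=> r0; have [k k0 kP] := P_norm_bound hP r0.
have cP : continuous (P r).
  move=> v; apply/cvgrPdist_lt => e e0.
  have k1 : 0 < k + 1 by rewrite ltr_wpDl.
  have d0 : 0 < e / (k + 1) by rewrite divr_gt0.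
  apply/nbhs_ballP; exists (e / (k + 1)) => //= w; rewrite -ball_normE /=.
  rewrite ltr_pdivlMr// -linearB => h; apply: le_lt_trans (kP _) _.
  by apply: le_lt_trans h; rewrite mulrC ler_wpM2l// lerDl.
apply: (@closed_comp _ _ (P r) [set xi]); first by move=> v _; exact: cP.
exact/accessible_closed_set1/hausdorff_accessible/norm_hausdorff.
Qed.

Section Step.
(* One short step backwards from [r'] to [r]: [e] measures how far the flow and
   the projections move, and [M] bounds the projections. *)
Variables (n r r' M e k : R).
Hypotheses (r0 : 0 <= r) (rr' : r <= r') (r'n : r' <= n) (M0 : 0 <= M) (e0 : 0 < e)
  (PM : forall v, `|P r v| <= M * `|v|) (PM' : forall v, `|P r' v| <= M * `|v|)
  (nearP : forall v, `|P r' v - P r v| <= e * `|v|)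
  (nearU : forall v v', `|(U r' r v - U r' r v') - (v - v')| <= e * `|v - v'|).

Lemma Q_norm_bound q v : (forall v, `|P q v| <= M * `|v|) ->
  `|Q q v| <= (1 + M) * `|v|.
Proof.
by move=> h; apply: le_trans (ler_normB _ _) _; rewrite mulrDl mul1r lerD2l.
Qed.

Lemma nearQ v : `|Q r v - Q r' v| <= e * `|v|.
Proof. by rewrite /Q /Q_ sub_interchange subrr sub0r opprB distrC distrC. Qed.

Lemma step_P v v' : `|P r' (U r' r v - U r' r v')| <=
  `|P r (v - v')| + (1 + M) * e * `|v - v'|.
Proof.
have -> : P r' (U r' r v - U r' r v') =
  P r (v - v') + (P r' (v - v') - P r (v - v')) +
  P r' (U r' r v - U r' r v' - (v - v')).
  by rewrite [P r _ + _]addrC subrK -linearD subrKC.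
have h1 := nearP (v - v'); have h2 := PM' (U r' r v - U r' r v' - (v - v')).
have h3 := ler_wpM2l M0 (nearU v v').
apply: le_trans (ler_normD _ _) _.
have := ler_normD (P r (v - v')) (P r' (v - v') - P r (v - v')).
by lra.
Qed.

(** One step turns the constant [k] into [k] plus a multiple of [e]; the room
    between [k] and [1] absorbs it. *)
Lemma cone_step : 0 <= k -> k < 1 -> (3 + 2 * M) * e <= (1 - k) / 2 ->
  (forall v v', pullback n r' v -> pullback n r' v' ->
     `|Q r' (v - v')| <= k * `|P r' (v - v')|) ->
  cone_condition n r.
Proof.
move=> k0 k1 small strong v v' Wv Wv'.
have Wv1 := pullback_flow r0 rr' r'n Wv; have Wv'1 := pullback_flow r0 rr' r'n Wv'.
have h1 := strong _ _ Wv1 Wv'1.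
have h2 := step_P v v'.
have h3 := nearQ (v - v').
have h4 := Q_norm_bound (v - v' - (U r' r v - U r' r v')) PM'.
have h5 := nearU v v'; rewrite distrC in h5.
have h6 := norm_le_PQ r (v - v').
have h7 : `|Q r (v - v')| <= `|Q r' (U r' r v - U r' r v')| +
    `|Q r' (v - v' - (U r' r v - U r' r v'))| + `|Q r (v - v') - Q r' (v - v')|.
  have Qsplit : Q r (v - v') = Q r' (U r' r v - U r' r v') +
    Q r' (v - v' - (U r' r v - U r' r v')) + (Q r (v - v') - Q r' (v - v')).
    by rewrite -Q_add !subrKC.
  rewrite {1}Qsplit.
  apply: le_trans (ler_normD _ _) _; rewrite lerD2r; exact: ler_normD.
have M1 : 0 <= 1 + M by have := M0; lra.
have h8 := ler_wpM2l M1 h5.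
have h9 := ler_wpM2l k0 h2.
have d0 := normr_ge0 (v - v').
have h10 : k * ((1 + M) * e * `|v - v'|) <= (1 + M) * e * `|v - v'|.
  by rewrite ler_piMl ?mulr_ge0// ltW.
have h11 := ler_wpM2r d0 small.
have h12 : (1 - k) / 2 * `|v - v'| <=
    (1 - k) / 2 * (`|P r (v - v')| + `|Q r (v - v')|).
  by rewrite ler_wpM2l//; lra.
have h13 : (1 + k) / 2 * `|Q r (v - v')| <= (1 + k) / 2 * `|P r (v - v')| by lra.
by move: h13; rewrite ler_pM2l//; lra.
Qed.

(** The point of the pulled-back set over [xi] is the fixed point of [N], which
    corrects [v] along the unstable space by the failure of its image to lie on the
    graph at time [r']. On the fiber over [xi] the map is a contraction, because the
    flow and the projections hardly move. *)
Lemma surjective_step : (1 + M) * (3 + 2 * M) * e <= 1 / 2 ->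
  is_lipschitz_graph n r' ->
  forall xi, E r xi -> exists2 v, pullback n r v & P r v = xi.
Proof.
move=> small [cone surj] xi Exi; have r'0 := le_trans r0 rr'.
have e1 : e < 1.
  have : 1 * 3 * e <= (1 + M) * (3 + 2 * M) * e.
    have M0' := M0; have e0' := e0.
    by rewrite ler_wpM2r ?ler_pM//; lra.
  by lra.
have /choice [S SP] : forall p, exists v, E r' p -> pullback n r' v /\ P r' v = p.
  move=> p; have [Ep|nEp] := pselect (E r' p); last by exists 0.
  by have [v Wv Pv] := surj p Ep; exists v.
have SW w : pullback n r' (S (P r' w)) by have [] := SP _ (E_P P r' w).
have SPE w : P r' (S (P r' w)) = P r' w by have [] := SP _ (E_P P r' w).
pose y v := U r' r v - S (P r' (U r' r v)).
have Py v : P r' (y v) = 0 by rewrite /y linearB SPE subrr.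
pose N v := v - Q r (y v).
have [v Pv vN] : exists2 v, P r v = xi & v = N v.
  apply: (@contraction_fixed_point _ _ [set v | P r v = xi] N (1 / 2)) => //.
  - exact: P_closed_fiber.
  - by exists xi; exact: (P_E hP r0 Exi).
  - by move=> v /= Pv; rewrite /N linearB (P_Q hP)// subr0.
  - by lra.
  move=> v v' /= Pv Pv'.
  have PD : P r (v - v') = 0 by rewrite linearB Pv Pv' subrr.
  have QD : Q r (v - v') = v - v' by exact: Q_F.
  set D1 := U r' r v - U r' r v'.
  set DS := S (P r' (U r' r v)) - S (P r' (U r' r v')).
  have -> : N v - N v' = Q r (v - v' - D1) + Q r DS.
    have yE : y v - y v' = D1 - DS by exact: sub_interchange.
    rewrite /N sub_interchange -[Q r (y v) - _]Q_sub yE -{1}QD -[LHS]Q_sub -Q_add.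
    by congr (Q r _); rewrite opprB addrA addrAC.
  have M1 : 0 <= 1 + M by have := M0; lra.
  have h1 := Q_norm_bound (v - v' - D1) PM.
  have h2 := Q_norm_bound DS PM.
  have h3 : `|DS| <= 2 * `|P r' D1|.
    apply: le_trans (norm_le_PQ r' _) _; have := cone _ _ (SW (U r' r v)) (SW (U r' r v')).
    by rewrite -/DS {1 3}/DS [P r' (_ - _)]linearB !SPE -linearB -/D1; lra.
  have h4 := step_P v v'; rewrite PD normr0 add0r -/D1 in h4.
  have h5 := nearU v v'; rewrite distrC -/D1 in h5.
  apply: le_trans (ler_normD _ _) _.
  apply: le_trans (lerD h1 h2) _.
  have h6 : (1 + M) * `|v - v' - D1| <= (1 + M) * (e * `|v - v'|) by rewrite ler_wpM2l.
  have h7 : (1 + M) * `|DS| <= (1 + M) * (2 * ((1 + M) * e * `|v - v'|)).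
    by rewrite ler_wpM2l//; lra.
  have := ler_wpM2r (normr_ge0 (v - v')) small.
  by lra.
have Qy : Q r (y v) = 0.
  by apply/eqP; rewrite -oppr_eq0 -[X in X == _](addKr v) -/(N v) -vN addNr.
have y0 : y v = 0.
  have h := nearQ (y v); rewrite Qy sub0r normrN in h.
  have Qy' : Q r' (y v) = y v by exact: Q_F.
  rewrite Qy' in h; apply/eqP; rewrite -normr_le0.
  have : 0 <= (1 - e) * (0 - `|y v|) by lra.
  by rewrite pmulr_rge0; lra.
exists v => //; apply: (pullback_flow_inv r0 rr' r'n).
by have -> : U r' r v = S (P r' (U r' r v)) by apply/eqP; rewrite -subr_eq0 -/(y v) y0.
Qed.

End Step.

Section Truncation.
Variables (al be : R).
Hypotheses (al0 : 0 <= al) (be0 : 0 <= be) (al1 : 2 * al < 1)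
  (hal : forall t s, 0 <= s -> s <= t ->
     (\int[mu]_(r in `[s, t]) (a t r * a r s * Lip (f r))%:E <= (al * a t s)%:E)%E)
  (hbe : forall s, 0 <= s ->
     (\int[mu]_(r in `[s, +oo[) (b r s * a r s * Lip (f r))%:E <= be%:E)%E)
  (nz : exists2 z, z != 0 & E_ P 0 z).
Let kap := 2 * (1 - 2 * al)^-1 * be.
Hypothesis kap1 : kap < 1.

(** The unstable part of a difference vanishes at time [n], so the cone condition
    after [s] reproduces itself at [s] with the smaller constant [kap]. *)
Lemma cone_condition_strict n s : 0 <= s -> s <= n ->
  (forall r, s <= r -> r <= n -> cone_condition n r) ->
  forall v v', pullback n s v -> pullback n s v' ->
    `|Q s (v - v')| <= kap * `|P s (v - v')|.
Proof.
move=> s0 sn cone v v' Wv Wv'.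
have := unstable_slaving hA hT ha hb hP cf lf al0 al1 hal hbe nz s0 sn
  (U_solution v s0) (U_solution v' s0).
rewrite [X in b n s * X](_ : _ = 0); last first.
  move: Wv Wv'; rewrite /pullback /= => Qv Qv'.
  by rewrite Q_sub -/Q Qv Qv' subrr normr0.
rewrite mulr0 add0r; apply=> r sr rn.
have := cone r sr rn _ _ (pullback_flow s0 sr rn Wv) (pullback_flow s0 sr rn Wv').
by have := norm_le_PQ r (U r s v - U r s v'); lra.
Qed.

(** The strict cone condition leaves room for a step backwards, whose length is
    controlled near each time; Cousin's lemma chains the steps. *)
Lemma lipschitz_graph_backward n : 0 <= n ->
  forall r, 0 <= r -> r <= n -> is_lipschitz_graph n r.
Proof.
move=> n0; have [M M0 MP] := P_bounded hA hT hP (lexx 0) n0.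
have kap0 : 0 <= kap by rewrite !mulr_ge0// invr_ge0 ltW// subr_gt0.
have k0' : 0 < 1 - kap by rewrite subr_gt0.
pose e := Num.min ((1 - kap) / 2 / (3 + 2 * M)) (1 / 2 / ((1 + M) * (3 + 2 * M))).
have M1 : 0 < 1 + M by lra.
have M3 : 0 < 3 + 2 * M by lra.
have M13 : 0 < (1 + M) * (3 + 2 * M) by rewrite mulr_gt0.
have e0 : 0 < e.
  by rewrite lt_min; apply/andP; split; rewrite !divr_gt0.
have e1 : (3 + 2 * M) * e <= (1 - kap) / 2.
  by rewrite mulrC -ler_pdivlMr// ge_min lexx.
have e2 : (1 + M) * (3 + 2 * M) * e <= 1 / 2.
  by rewrite mulrC -ler_pdivlMr// ge_min lexx orbT.
suff h s : 0 <= s -> s <= n -> (forall p, n <= p -> p <= n -> is_lipschitz_graph n p) ->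
    forall p, s <= p -> p <= n -> is_lipschitz_graph n p.
  move=> r r0 rn; apply: (h r r0 rn) => // p np pn.
  by have -> : p = n by [apply/le_anti; rewrite pn]; exact: lipschitz_graph_end.
move=> s0 sn.
apply: (@cousin _ (fun p q => (forall r, q <= r -> r <= n -> is_lipschitz_graph n r) ->
  forall r, p <= r -> r <= n -> is_lipschitz_graph n r) s n sn).
  by move=> r1 r2 r3 _ _ _ _ h12 h23 /h23 /h12.
move=> c sc cn; have c0 := le_trans s0 sc.
have [d1 d10 d1P] := U_near_identity c0 e0.
have [d2 d20 d2P] := P_near hA hT hP c0 e0.
exists (Num.min d1 d2); first by rewrite lt_min d10.
move=> p q sp qn; rewrite ltrBlDr -ltrBlDl lt_min => /andP[cp1 cp2] pc cq.
rewrite -ltrBlDl lt_min => /andP[cq1 cq2] good r pr rn.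
have [qr|/ltW rq] := leP q r; first exact: good.
have r0 : 0 <= r by rewrite (le_trans s0)// (le_trans sp).
have q0 := le_trans r0 rq.
have nearP v : `|P q v - P r v| <= e * `|v| by apply: d2P => //; lra.
have nearU v v' : `|U q r v - U q r v' - (v - v')| <= e * `|v - v'|.
  by apply: d1P => //; lra.
have PM v : `|P r v| <= M * `|v| by exact: MP.
have PM' v : `|P q v| <= M * `|v| by exact: MP.
split.
  apply: (cone_step r0 rq qn M0 e0 PM' nearP nearU kap0 kap1 e1).
  apply: cone_condition_strict => // t qt tn.
  by have [] := good t qt tn.
exact: (surjective_step r0 rq qn M0 e0 PM PM' nearP nearU e2 (good q (lexx q) qn)).
Qed.

(** The requirements on the unknown of the theorem, up to time [n]. That a vector
    [w] lies on the graph at time [t] is expressed by [Q t w = phi t (P t w)]. *)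
Definition invariant_graph_upto (n : R) (phi : R -> X -> X) : Prop :=
  forall r, 0 <= r -> r <= n ->
  [/\ phi r 0 = 0,
      forall xi, E r xi -> P r (phi r xi) = 0,
      forall xi xi', E r xi -> E r xi' -> `|phi r xi - phi r xi'| <= `|xi - xi'| &
      forall t xi, r <= t -> t <= n -> E r xi ->
        Q t (U t r (xi + phi r xi)) = phi t (P t (U t r (xi + phi r xi)))].

(** Over each point of the stable space the pulled-back set has exactly one point,
    by the cone condition; the flow maps these sets into each other. *)
Lemma invariant_graph_upto_exists n : 0 <= n -> exists phi, invariant_graph_upto n phi.
Proof.
move=> n0; have good := lipschitz_graph_backward n0.
have /choice [phi phiP] : forall z : R * X, exists w,
    0 <= z.1 -> z.1 <= n -> E z.1 z.2 ->
    pullback n z.1 (z.2 + w) /\ P z.1 (z.2 + w) = z.2.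
  move=> [r xi] /=; have [[r0 rn Exi]|no] := pselect [/\ 0 <= r, r <= n & E r xi].
    have [_ surj] := good r r0 rn; have [v Wv Pv] := surj xi Exi.
    by exists (v - xi); rewrite subrKC.
  by exists 0 => r0 rn Exi; exfalso; apply: no.
have Pphi r xi : 0 <= r -> r <= n -> E r xi -> P r (phi (r, xi)) = 0.
  move=> r0 rn Exi; have [_] := phiP (r, xi) r0 rn Exi.
  by rewrite linearD /= (P_E hP r0 Exi) => /(canRL (addKr _)); rewrite addNr.
exists (fun r xi => phi (r, xi)) => r r0 rn.
have [cone _] := good r r0 rn.
have spec xi : E r xi ->
    pullback n r (xi + phi (r, xi)) /\ P r (xi + phi (r, xi)) = xi.
  by move=> Exi; exact: (phiP (r, xi)).
split.
- have E00 : E r 0 by exists 0; rewrite // linear0.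
  have [W0 P0] := spec 0 E00; rewrite add0r in W0 P0.
  apply: (cone_eq cone) => //; last by rewrite P0 linear0.
  by rewrite /pullback /= U_zero// /Q /Q_ linear0 subr0.
- by move=> xi; exact: Pphi.
- move=> xi xi' Exi Exi'; have [W1 P1] := spec xi Exi; have [W2 P2] := spec xi' Exi'.
  have := cone _ _ W1 W2; rewrite linearB P1 P2.
  rewrite opprD addrACA Q_add.
  have -> : Q r (xi - xi') = 0.
    by rewrite /Q /Q_ linearB (P_E hP r0 Exi) (P_E hP r0 Exi') subrr.
  by rewrite add0r [Q r _]Q_F// /F_ /= linearB !Pphi// subrr.
- move=> t xi rt tn Exi; have [W1 P1] := spec xi Exi.
  have t0 := le_trans r0 rt.
  have Wt := pullback_flow r0 rt tn W1.
  set u := U t r _ in Wt *.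
  have [cone_t _] := good t t0 tn.
  have [W2 P2] := phiP (t, P t u) t0 tn (E_P P t u).
  have uE := cone_eq cone_t Wt W2 (esym P2).
  have QP : Q t (P t u) = 0 by rewrite /Q /Q_ (P_idem hP)// subrr.
  by rewrite {1}uE Q_add QP add0r [Q t _]Q_F//; apply: Pphi => //; exact: E_P.
Qed.

End Truncation.

End PullBack.

(** * Convergence of the graphs *)

(** [reverse_fatou_domination], uniformly over families [H n] of functions: a
    failure would provide a sequence of functions that contradicts it. *)
Lemma uniform_reverse_fatou (R : realType) d (T : measurableType d)
    (nu : {measure set T -> \bar R}) (D : set T)
    (H : nat -> (T -> R) -> Prop) (g : T -> R) (K c M : R) :
  measurable D ->
  (forall n h, H n h -> [/\ measurable_fun D h, forall x, D x -> 0 <= h x &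
     forall x, D x -> h x <= K * g x]) -> 0 <= K ->
  (forall x, D x -> 0 <= g x) ->
  (\int[nu]_(x in D) (g x)%:E <= M%:E)%E -> 0 <= c ->
  (forall x, D x -> forall e : R, 0 < e ->
     exists N, forall n h, (N <= n)%N -> H n h -> h x <= c * g x + e) ->
  forall e : R, 0 < e ->
     exists N, forall n h, (N <= n)%N -> H n h ->
       (\int[nu]_(x in D) (h x)%:E <= (c * M + e)%:E)%E.
Proof.
move=> mD hH K0 g0 gM c0 hc e e0; apply/not_existsP => bad.
have /choice [p pP] : forall N, exists p : nat * (T -> R),
    [/\ (N <= p.1)%N, H p.1 p.2 &
     ~~ (\int[nu]_(x in D) (p.2 x)%:E <= (c * M + e)%:E)%E].
  move=> N; have /existsNP [n /existsNP [h]] := bad N.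
  by move=> /not_implyP[Nn /not_implyP[Hh /negP nle]]; exists (n, h).
have [||||N NP] := @reverse_fatou_domination R d T nu D (fun n => (p n).2) g K c M
    mD _ _ K0 g0 _ gM c0 _ e e0.
- by move=> n; have [_ Hh _] := pP n; have [] := hH _ _ Hh.
- by move=> n; have [_ Hh _] := pP n; have [] := hH _ _ Hh.
- by move=> n; have [_ Hh _] := pP n; have [] := hH _ _ Hh.
- move=> x Dx k k0; have [N NP] := hc x Dx k k0; exists N => n Nn.
  have [np Hh _] := pP n; apply: (NP (p n).1) => //; exact: leq_trans np.
by have [_ _ /negP] := pP N; apply; exact: NP.
Qed.

Section Convergence.
Context {R : realType} {X : completeNormedModType R}.
Local Notation mu := (@lebesgue_measure R).
Variables (A : R -> {linear X -> X}) (T : R -> R -> X -> X)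
  (P : R -> {linear X -> X}) (a b : R -> R -> R) (f : R -> X -> X)
  (U : R -> R -> X -> X).
Hypotheses (hA : family_continuous A)
  (hT : solution_family (fun t x => A t x) T)
  (ha : forall t s, 0 <= s -> s <= t -> 0 < a t s)
  (hb : forall t s, 0 <= s -> s <= t -> 0 < b t s)
  (hP : general_dichotomy T P a b)
  (cf : field_continuous f) (lf : lip_field f)
  (f0 : forall t, 0 <= t -> f t 0 = 0)
  (hU : solution_family (fun t x => A t x + f t x) U)
  (uU : unique_solutions (fun t x => A t x + f t x))
  (hab : forall s, 0 <= s -> forall e : R, 0 < e ->
     exists t0 : R, forall t, t0 <= t -> s <= t -> a t s * b t s <= e).
Let G t x := A t x + f t x.
Let Q := Q_ P.
Let E := E_ P.
Variables (al be : R).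
Hypotheses (al0 : 0 <= al) (be0 : 0 <= be) (al1 : 2 * al < 1)
  (hal : forall t s, 0 <= s -> s <= t ->
     (\int[mu]_(r in `[s, t]) (a t r * a r s * Lip (f r))%:E <= (al * a t s)%:E)%E)
  (hbe : forall s, 0 <= s ->
     (\int[mu]_(r in `[s, +oo[) (b r s * a r s * Lip (f r))%:E <= be%:E)%E)
  (nz : exists2 z, z != 0 & E_ P 0 z).
Let C := (1 - 2 * al)^-1.
Let q := 2 * al + C * be.

Lemma C_gt0 : 0 < C.
Proof. by rewrite invr_gt0 subr_gt0. Qed.

Lemma invariant_graph_split n phi s t xi : invariant_graph_upto P U n phi ->
  0 <= s -> s <= t -> t <= n -> E s xi ->
  U t s (xi + phi s xi) =
    P t (U t s (xi + phi s xi)) + phi t (P t (U t s (xi + phi s xi))).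
Proof.
move=> hphi s0 st tn Exi; have [_ _ _ inv] := hphi s s0 (le_trans st tn).
by rewrite -(inv t xi st tn Exi) P_add_Q.
Qed.

(** On an invariant graph the solutions lie in a cone around the stable spaces,
    so that they decay like the stable part of the linear flow. *)
Lemma invariant_graph_decay n phi s t xi xi' : invariant_graph_upto P U n phi ->
  0 <= s -> s <= t -> t <= n -> E s xi -> E s xi' ->
  `|P t (U t s (xi + phi s xi) - U t s (xi' + phi s xi'))| <=
      C * a t s * `|xi - xi'| /\
  `|U t s (xi + phi s xi) - U t s (xi' + phi s xi')| <=
      2 * (C * a t s * `|xi - xi'|).
Proof.
move=> hphi s0 st tn Exi Exi'.
have cone r : s <= r -> r <= t ->
    `|U r s (xi + phi s xi) - U r s (xi' + phi s xi')| <=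
    2 * `|P r (U r s (xi + phi s xi) - U r s (xi' + phi s xi'))|.
  move=> sr rt; have rn := le_trans rt tn.
  have r0 := le_trans s0 sr; have [_ _ lip _] := hphi r r0 rn.
  have h1 := invariant_graph_split hphi s0 sr rn Exi.
  have h2 := invariant_graph_split hphi s0 sr rn Exi'.
  have := lip _ _ (E_P P r (U r s (xi + phi s xi))) (E_P P r (U r s (xi' + phi s xi'))).
  rewrite -linearB => h3.
  rewrite {1}h1 {1}h2 opprD addrACA -linearB.
  by apply: le_trans (ler_normD _ _) _; lra.
have [_ Fphi _ _] := hphi s s0 (le_trans st tn).
have dP : P s (xi + phi s xi - (xi' + phi s xi')) = xi - xi'.
  by rewrite linearB !(linearD (P s)) /= !Fphi// !addr0 (P_E hP s0 Exi) (P_E hP s0 Exi').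
have := stable_decay hA hT ha hP cf lf al0 al1 hal nz s0 st
  (U_solution hU _ s0) (U_solution hU _ s0) cone st (lexx t).
rewrite dP => h; split => //.
by apply: le_trans (cone t st (lexx t)) _; rewrite ler_wpM2l.
Qed.

Lemma invariant_graph_bound n phi s t xi : invariant_graph_upto P U n phi ->
  0 <= s -> s <= t -> t <= n -> E s xi ->
  `|P t (U t s (xi + phi s xi))| <= C * a t s * `|xi| /\
  `|U t s (xi + phi s xi)| <= 2 * (C * a t s * `|xi|).
Proof.
move=> hphi s0 st tn Exi; have [phi0 _ _ _] := hphi s s0 (le_trans st tn).
have E00 : E s 0 by exists 0; rewrite // linear0.
have := invariant_graph_decay hphi s0 st tn Exi E00.
by rewrite phi0 addr0 (U_zero f0 hU uU)// !subr0.
Qed.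

Variable Phi : nat -> R -> X -> X.
Hypothesis hPhi : forall n, invariant_graph_upto P U n%:R (Phi n).
Let u n s xi t := U t s (xi + Phi n s xi).

(** The distance between the solutions on two graphs of large index, measured by
    the rate [a t s] at which both decay. The term [e] leaves room for the choice
    of the indices, which depends on [s] and [t] but not on [xi]. *)
Definition asymptotic_gap (M : R) : Prop := forall s t, 0 <= s -> s <= t ->
  forall e : R, 0 < e -> exists N : nat, forall m m' xi, (N <= m)%N -> (N <= m')%N ->
    E s xi -> `|u m s xi t - u m' s xi t| <= (M * a t s + e) * `|xi|.

Lemma nat_above (t : R) : exists N : nat, forall m, (N <= m)%N -> t <= m%:R.
Proof.
exists (Num.bound `|t|) => m Nm; apply: le_trans (ler_norm t) _.
by rewrite (le_trans (ltW (archi_boundP (normr_ge0 t))))// ler_nat.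
Qed.

Lemma u_zero n s t : 0 <= s -> s <= t -> s <= n%:R -> u n s 0 t = 0.
Proof.
move=> s0 st sn; have [phi0 _ _ _] := hPhi s0 sn.
by rewrite /u phi0 addr0 (U_zero f0 hU uU).
Qed.

Lemma asymptotic_gap_start : asymptotic_gap (4 * C).
Proof.
move=> s t s0 st e e0; have [N NP] := nat_above t; exists N => m m' xi Nm Nm' Exi.
have [_ h1] := invariant_graph_bound (hPhi (n := m)) s0 st (NP m Nm) Exi.
have [_ h2] := invariant_graph_bound (hPhi (n := m')) s0 st (NP m' Nm') Exi.
apply: le_trans (ler_normB _ _) _.
have : 0 <= e * `|xi| by rewrite mulr_ge0// ltW.
by rewrite /u; lra.
Qed.

Section Improvement.
Variable M : R.
Hypotheses (M0 : 0 <= M) (gapM : asymptotic_gap M).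

Lemma gap_crude m m' s t xi : 0 <= s -> s <= t -> t <= m%:R -> t <= m'%:R ->
  E s xi -> `|u m s xi t - u m' s xi t| <= 4 * C * a t s * `|xi|.
Proof.
move=> s0 st tm tm' Exi.
have [_ h1] := invariant_graph_bound (hPhi (n := m)) s0 st tm Exi.
have [_ h2] := invariant_graph_bound (hPhi (n := m')) s0 st tm' Exi.
by apply: le_trans (ler_normB _ _) _; rewrite /u; lra.
Qed.

(** The integrals of the variation of constants formulas, between solutions on
    two graphs of large index: the reverse Fatou lemma replaces the distance of
    the solutions, inside the integral, by its asymptotic bound. *)
Lemma integrand_gap (w : R -> R) (s J : R) (D : set R) : 0 <= s -> measurable D ->
  (forall r, D r -> s <= r) -> (forall r, D r -> 0 <= w r) ->
  (\int[mu]_(r in D) (w r * a r s * Lip (f r))%:E <= J%:E)%E ->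
  forall e : R, 0 < e -> exists N : nat, forall n, (N <= n)%N ->
  forall m m' xi (p : R) (h : R -> R), (n <= m)%N -> (n <= m')%N -> E s xi ->
  xi != 0 -> p <= n%:R -> `[s, p] `<=` D -> contI s p h -> (forall r, 0 <= h r) ->
  (forall r, s <= r -> r <= p ->
     h r <= w r * (Lip (f r) * `|u m s xi r - u m' s xi r|)) ->
  (\int[mu]_(r in `[s, p]) (h r)%:E <= (`|xi| * (M * J + e))%:E)%E.
Proof.
move=> s0 mD Ds w0 gJ e e0.
pose g r := w r * a r s * Lip (f r).
pose near_pair (n : nat) (h : R -> R) := exists m m' xi (p : R),
  [/\ (n <= m)%N /\ (n <= m')%N, E s xi /\ xi != 0, p <= n%:R,
      (forall r, ~~ (s <= r <= p) -> h r = 0) &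
      forall r, s <= r -> r <= p ->
        h r * `|xi| <= w r * (Lip (f r) * `|u m s xi r - u m' s xi r|)].
pose H (n : nat) (h : R -> R) := [/\ measurable_fun D h, forall r, D r -> 0 <= h r,
  (forall r, D r -> h r <= 4 * C * g r) & near_pair n h].
have a0 r : s <= r -> 0 < a r s by exact: ha.
have g0 r : D r -> 0 <= g r.
  by move=> Dr; rewrite !mulr_ge0 ?Lip_ge0 ?w0// ltW// a0// Ds.
have C0 : 0 <= 4 * C by rewrite mulr_ge0// ltW// C_gt0.
have [||N NP] := @uniform_reverse_fatou R _ _ mu D H g (4 * C) M J mD
    _ C0 g0 gJ M0 _ e e0.
- by move=> n h [].
- move=> r Dr k k0; have sr := Ds r Dr.
  have W0 : 0 <= w r * Lip (f r) by rewrite mulr_ge0 ?Lip_ge0 ?w0.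
  have W1 : 0 < w r * Lip (f r) + 1 by rewrite ltr_wpDl.
  have k10 : 0 < k / (w r * Lip (f r) + 1) by rewrite divr_gt0.
  have [N NP] := gapM s0 sr k10; exists N => n h Nn [_ _ _].
  move=> [m [m' [xi [p [[nm nm'] [Exi xi0] pn hout hin]]]]].
  have rhs0 : 0 <= M * g r + k.
    by apply: addr_ge0; [apply: mulr_ge0 => //; exact: g0 | exact: ltW].
  have [/andP[_ rp]|/hout->//] := boolP (s <= r <= p).
  have nxi : 0 < `|xi| by rewrite normr_gt0.
  rewrite -(ler_pM2r nxi); apply: le_trans (hin r sr rp) _.
  have := NP m m' xi (leq_trans Nn nm) (leq_trans Nn nm') Exi.
  move=> /(ler_wpM2l W0); rewrite -mulrA => /le_trans; apply.
  rewrite mulrA ler_pM2r// mulrDr.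
  have : w r * Lip (f r) * (k / (w r * Lip (f r) + 1)) <= k.
    by rewrite mulrCA ler_piMr ?(ltW k0)// ler_pdivrMr//; lra.
  by rewrite /g; lra.
exists N => n Nn m m' xi p h nm nm' Exi xi0 pn spD ch h0 hle.
have nxi : 0 < `|xi| by rewrite normr_gt0.
pose h1 r := h r / `|xi|.
pose h2 := h1 \_ `[s, p].
have mh : measurable_fun `[s, p] h by exact: contI_measurable.
have mh1 : measurable_fun `[s, p] h1 by apply: measurable_funM.
have h2in r : s <= r -> r <= p -> h2 r = h1 r.
  by move=> sr rp; rewrite /h2 patchE mem_set//= in_itv /= sr.
have h2out r : ~~ (s <= r <= p) -> h2 r = 0.
  move=> nr; rewrite /h2 patchE ifF//; apply/negP; rewrite inE /= in_itv /=.
  exact/negP.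
have h2le r : s <= r -> r <= p ->
    h2 r * `|xi| <= w r * (Lip (f r) * `|u m s xi r - u m' s xi r|).
  by move=> sr rp; rewrite h2in// /h1 divfK ?gt_eqF// hle.
have h20 r : 0 <= h2 r.
  have [/andP[sr rp]|/h2out->//] := boolP (s <= r <= p).
  by rewrite h2in// divr_ge0.
have Hh2 : H n h2.
  split.
  - by apply: measurable_funTS; exact/(measurable_restrictT _ _).1.
  - by [].
  - move=> r Dr; have [/andP[sr rp]|/h2out->] := boolP (s <= r <= p); last first.
      by rewrite mulr_ge0 ?g0.
    rewrite -(ler_pM2r nxi); apply: le_trans (h2le r sr rp) _.
    have pm : r <= m%:R by rewrite (le_trans rp)// (le_trans pn)// ler_nat.
    have pm' : r <= m'%:R by rewrite (le_trans rp)// (le_trans pn)// ler_nat.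
    have W0 : 0 <= w r * Lip (f r) by rewrite mulr_ge0 ?Lip_ge0 ?w0.
    have := ler_wpM2l W0 (gap_crude s0 sr pm pm' Exi).
    by rewrite /g; lra.
  - by exists m, m', xi, p.
have int_h2 : (\int[mu]_(r in `[s, p]) (h2 r)%:E <= (M * J + e)%:E)%E.
  apply: le_trans (NP n h2 Nn Hh2); apply: le_integral_subset_nomeas => // r _.
  - by rewrite lee_fin.
  - by rewrite lee_fin.
apply: integral_domination int_h2 => //.
move=> r; rewrite /= in_itv /= => /andP[sr rp].
by rewrite h2in// /h1 mulrCA mulfV ?mulr1// gt_eqF.
Qed.

(** The initial stable parts coincide, so only the integral remains. *)
Lemma stable_gap s t : 0 <= s -> s <= t -> forall e : R, 0 < e ->
  exists N : nat, forall m m' xi, (N <= m)%N -> (N <= m')%N -> E s xi ->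
    `|P t (u m s xi t - u m' s xi t)| <= (M * (al * a t s) + e) * `|xi|.
Proof.
move=> s0 st e e0.
have Ds r : `[s, t]%classic r -> s <= r by rewrite /= in_itv /= => /andP[].
have w0 r : `[s, t]%classic r -> 0 <= a t r.
  rewrite /= in_itv /= => /andP[sr rt]; apply/ltW/ha => //; exact: le_trans sr.
have [N1 N1P] := integrand_gap s0 (measurable_itv _) Ds w0 (hal s0 st) e0.
have [N2 N2P] := nat_above t.
pose N := maxn N1 N2; exists N => m m' xi Nm Nm' Exi.
have tN : t <= N%:R by apply: N2P; exact: leq_maxr.
have tm : t <= m%:R by rewrite (le_trans tN)// ler_nat.
have tm' : t <= m'%:R by rewrite (le_trans tN)// ler_nat.
have [->|xi0] := eqVneq xi 0.
  by rewrite !u_zero ?(le_trans st)// subrr linear0 !normr0 mulr0.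
have [h [ch h0 hle hP']] := stable_integrand hA hT ha hP cf lf s0 st
  (U_solution hU (xi + Phi m s xi) s0) (U_solution hU (xi + Phi m' s xi) s0).
have := hP' _ (N1P N (leq_maxl _ _) m m' xi t h Nm Nm' Exi xi0 tN _ ch h0 hle).
have -> : P s (xi + Phi m s xi - (xi + Phi m' s xi)) = 0.
  have [_ F1 _ _] := hPhi (n := m) s0 (le_trans st tm).
  have [_ F2 _ _] := hPhi (n := m') s0 (le_trans st tm').
  by rewrite opprD addrACA subrr add0r linearB F1// F2// subrr.
rewrite normr0 mulr0 add0r mulrC; apply.
exact: subset_refl.
Qed.

(** The boundary term at the horizon [N] is at most [2 * C * a * b]. *)
Lemma unstable_gap s : 0 <= s -> forall e : R, 0 < e ->
  exists N : nat, forall m m' xi, (N <= m)%N -> (N <= m')%N -> E s xi ->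
    `|Phi m s xi - Phi m' s xi| <= (M * be + e) * `|xi|.
Proof.
move=> s0 e e0; have e20 : 0 < e / 2 by lra.
have Ds r : `[s, +oo[%classic r -> s <= r by rewrite /= in_itv /= => /andP[].
have w0 r : `[s, +oo[%classic r -> 0 <= b r s.
  by rewrite /= in_itv /= => /andP[sr _]; apply/ltW/hb.
have [N1 N1P] := integrand_gap s0 (measurable_itv _) Ds w0 (hbe s0) e20.
have C0 := C_gt0.
have C20 : 0 < 2 * C by rewrite mulr_gt0.
have e40 : 0 < e / 2 / (2 * C) by exact: divr_gt0.
have [t0 t0P] := hab s0 e40.
have [N2 N2P] := nat_above (Num.max s t0).
pose N := maxn N1 N2; exists N => m m' xi Nm Nm' Exi.
have : Num.max s t0 <= N%:R by apply: N2P; exact: leq_maxr.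
rewrite ge_max => /andP[sN t0N].
have Nm1 : N%:R <= m%:R :> R by rewrite ler_nat.
have Nm1' : N%:R <= m'%:R :> R by rewrite ler_nat.
have [phi0 F1 _ _] := hPhi (n := m) s0 (le_trans sN Nm1).
have [phi0' F2 _ _] := hPhi (n := m') s0 (le_trans sN Nm1').
have [->|xi0] := eqVneq xi 0; first by rewrite phi0 phi0' subrr !normr0 mulr0.
have [h [ch h0 hle hP']] := unstable_integrand hA hT hb hP cf lf s0 sN
  (U_solution hU (xi + Phi m s xi) s0) (U_solution hU (xi + Phi m' s xi) s0).
have := hP' _ (N1P N (leq_maxl _ _) m m' xi N%:R h Nm Nm' Exi xi0 (lexx _) _ ch h0 hle).
have -> : Q_ P s (xi + Phi m s xi - (xi + Phi m' s xi)) = Phi m s xi - Phi m' s xi.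
  rewrite opprD addrACA subrr add0r; apply: Q_F.
  by rewrite /F_ /= linearB F1// F2// subrr.
have Q_small k : (N <= k)%N ->
    `|Q N%:R (U N%:R s (xi + Phi k s xi))| <= C * a N%:R s * `|xi|.
  move=> Nk; have Nk1 : N%:R <= k%:R :> R by rewrite ler_nat.
  have [_ _ _ inv] := hPhi (n := k) s0 (le_trans sN Nk1).
  rewrite [Q _ _]inv//; have N0 := le_trans s0 sN.
  have [z0 _ lip _] := hPhi (n := k) N0 Nk1.
  have E00 : E N%:R 0 by exists 0; rewrite // linear0.
  have := lip _ _ (E_P P N%:R (U N%:R s (xi + Phi k s xi))) E00.
  rewrite z0 !subr0 => /le_trans; apply.
  by have [] := invariant_graph_bound (hPhi (n := k)) s0 sN Nk1 Exi.
move=> /(_ _)/le_trans; apply; first by move=> r; rewrite /= !in_itv /= => /andP[->].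
have b0 : 0 < b N%:R s by exact: hb.
have hQ : `|Q_ P N%:R (U N%:R s (xi + Phi m s xi) - U N%:R s (xi + Phi m' s xi))| <=
    2 * (C * a N%:R s * `|xi|).
  rewrite Q_sub; apply: le_trans (ler_normB _ _) _.
  by have := Q_small m Nm; have := Q_small m' Nm'; rewrite /Q; lra.
have hbQ := ler_wpM2l (ltW b0) hQ.
have := t0P N%:R t0N sN; rewrite ler_pdivlMr ?mulr_gt0// => hab'.
have := ler_wpM2r (normr_ge0 xi) hab'.
by lra.
Qed.

(** The distance between two points on two graphs is at most twice that of their
    stable parts plus the distance of the graphs over one of these. *)
Lemma asymptotic_gap_step : asymptotic_gap (q * M).
Proof.
move=> s t s0 st e e0; have t0 := le_trans s0 st.
have a0 := ha s0 st; have C0 := C_gt0.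
have e40 : 0 < e / 4 by lra.
have e10 : 0 < e / 2 / (C * a t s) by rewrite !divr_gt0// mulr_gt0.
have [N1 N1P] := stable_gap s0 st e40.
have [N2 N2P] := unstable_gap t0 e10.
have [N3 N3P] := nat_above t.
exists (maxn N1 (maxn N2 N3)) => m m' xi.
rewrite !geq_max => /and3P[m1 m2 m3] /and3P[m'1 m'2 m'3] Exi.
have h1 := N1P m m' xi m1 m'1 Exi.
set y := P t (u m s xi t); set y' := P t (u m' s xi t).
have h2 := N2P m m' y m2 m'2 (E_P P t _).
have [_ _ lip _] := hPhi (n := m') t0 (N3P m' m'3).
have h3 := lip _ _ (E_P P t (u m s xi t)) (E_P P t (u m' s xi t)).
have [h4 _] := invariant_graph_bound (hPhi (n := m)) s0 st (N3P m m3) Exi.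
have um := invariant_graph_split (hPhi (n := m)) s0 st (N3P m m3) Exi.
have um' := invariant_graph_split (hPhi (n := m')) s0 st (N3P m' m'3) Exi.
have -> : u m s xi t - u m' s xi t = (y - y') +
    ((Phi m t y - Phi m' t y) + (Phi m' t y - Phi m' t y')).
  by rewrite [X in _ = _ + X]addrA subrK {1}/u {1}um {1}/u {1}um' opprD addrACA.
rewrite linearB -/y -/y' in h1; rewrite -/y -/y' in h3; rewrite -/y in h4.
apply: le_trans (ler_normD _ _) _.
have h5 := ler_normD (Phi m t y - Phi m' t y) (Phi m' t y - Phi m' t y').
have h6 := ler_wpM2l (ltW e10) h4.
have h7 := ler_wpM2l (mulr_ge0 M0 be0) h4.
have e1E : e / 2 / (C * a t s) * (C * a t s * `|xi|) = e / 2 * `|xi|.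
  by rewrite mulrA divfK// gt_eqF// mulr_gt0.
rewrite e1E in h6; rewrite /q.
by lra.
Qed.

End Improvement.

Hypothesis q1 : q < 1.

(** Iterating the improvement makes the gap arbitrarily small; at [t = s] it is the
    distance of the graphs. *)
Lemma invariant_graphs_cauchy s xi : 0 <= s -> E s xi -> forall e : R, 0 < e ->
  exists N : nat, forall m m', (N <= m)%N -> (N <= m')%N ->
    `|Phi m s xi - Phi m' s xi| <= e.
Proof.
move=> s0 Exi e e0; have C0 := C_gt0.
have a0 := ha s0 (lexx s).
have k0 : 0 < a s s * (`|xi| + 1) by rewrite mulr_gt0// ltr_wpDl.
have w0 : 0 < e / 2 / (a s s * (`|xi| + 1)) by rewrite !divr_gt0.
have q0 : 0 <= q by rewrite addr_ge0 ?mulr_ge0// ltW.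
have [M [M0 Mle gapM]] : exists M, [/\ 0 <= M, M <= 0 / (1 - q) + e / 2 / (a s s * (`|xi| + 1)) &
    asymptotic_gap M].
  apply: (@iterate_improvement _ asymptotic_gap 0 q (4 * C)) => //.
  - by rewrite mulr_ge0// ltW.
  - exact: asymptotic_gap_start.
  - by move=> M M0 gapM; rewrite add0r; exact: asymptotic_gap_step.
rewrite mul0r add0r in Mle.
have xi1 : 0 < `|xi| + 1 by rewrite ltr_wpDl.
have w10 : 0 < e / 2 / (`|xi| + 1) by rewrite !divr_gt0.
have [N NP] := gapM s s s0 (lexx s) _ w10.
exists N => m m' Nm Nm'; have := NP m m' xi Nm Nm' Exi.
rewrite /u !(U_id hU)// opprD addrACA subrr add0r => /le_trans; apply.
have h1 := ler_wpM2r (ltW k0) Mle; rewrite divfK ?gt_eqF// in h1.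
have h2 : e / 2 / (`|xi| + 1) * `|xi| <= e / 2.
  by rewrite mulrAC ler_pdivrMr// ler_wpM2l//; lra.
have : 0 <= M * a s s by rewrite mulr_ge0// ltW.
by rewrite mulrDl; lra.
Qed.

End Convergence.

(** * The limit graph *)

Section LimitGraph.
Context {R : realType} {X : completeNormedModType R}.
Local Notation mu := (@lebesgue_measure R).
Variables (A : R -> {linear X -> X}) (T : R -> R -> X -> X)
  (P : R -> {linear X -> X}) (a b : R -> R -> R) (f : R -> X -> X)
  (U : R -> R -> X -> X).
Hypotheses (hA : family_continuous A)
  (hT : solution_family (fun t x => A t x) T)
  (ha : forall t s, 0 <= s -> s <= t -> 0 < a t s)
  (hb : forall t s, 0 <= s -> s <= t -> 0 < b t s)
  (hP : general_dichotomy T P a b)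
  (cf : field_continuous f) (lf : lip_field f)
  (f0 : forall t, 0 <= t -> f t 0 = 0)
  (hU : solution_family (fun t x => A t x + f t x) U)
  (uU : unique_solutions (fun t x => A t x + f t x)).
Let Q := Q_ P.
Let E := E_ P.

Lemma graph_invariantP phi : calX P phi ->
  graph_invariant P U phi <-> forall n, invariant_graph_upto P U n phi.
Proof.
move=> [phi0 phiF phiL]; split=> [inv n r r0 rn|inv tau tau0 _ [[s v] [[r xi] [/= r0 Exi] [<- <-]] <-]].
  split; [exact: phi0|by move=> xi Exi; exact: phiF|by move=> *; exact: phiL|].
  move=> t xi rt tn Exi.
  have tr0 : 0 <= t - r by rewrite subr_ge0.
  have /(inv _ tr0) : (Psi U (t - r) @` graph_ P phi) (t, U t r (xi + phi r xi)).
    exists (r, xi + phi r xi); first by exists (r, xi).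
    by rewrite /Psi /= subrKC.
  move=> [[t' eta] [/= t'0 Eeta] [t't <-]]; rewrite t't in t'0 Eeta *.
  have Pphi : P t (phi t eta) = 0 by exact: phiF.
  rewrite linearD /= (P_E hP t'0 Eeta) Pphi addr0.
  by rewrite /Q_ linearD /= (P_E hP t'0 Eeta) Pphi addr0 addrC addKr.
have rt : r <= r + tau by rewrite lerDl.
have [_ _ _ h] := inv (r + tau) r r0 rt.
set u := U (r + tau) r (xi + phi r xi).
exists (r + tau, P (r + tau) u).
  by split => /=; [exact: addr_ge0 | exact: E_P].
rewrite /Psi /= -/u -(h (r + tau) xi rt (lexx _) Exi) -/u.
by rewrite P_add_Q.
Qed.

(** The projections vary continuously in the operator norm and have norm [0] or at
    least [1], so they cannot become nonzero. *)
Lemma trivial_stable_space : ~ (exists2 z, z != 0 & E_ P 0 z) ->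
  forall t xi, 0 <= t -> E t xi -> xi = 0.
Proof.
move=> nz t _ t0 [x _ <-].
have P0 y : P 0 y = 0.
  by apply/eqP; apply: contra_notT nz => Py; exists (P 0 y) => //; exists y.
move: P0 x.
apply: (@cousin _ (fun p q => (forall y, P p y = 0) -> forall y, P q y = 0) 0 t t0) => //.
  by move=> r1 r2 r3 _ _ _ _ h12 h23 /h12 /h23.
move=> c c0 ct; have half0 : 0 < 1 / 2 :> R by lra.
have [d d0 dP] := P_near hA hT hP c0 half0.
exists d => // p q p0 qt cp pc cq qc Pp y.
have := dP p q p0 cp (le_trans pc cq) qc (P q y).
rewrite (P_idem hP); last exact: le_trans cq.
rewrite Pp subr0 => h; apply/eqP; rewrite -normr_le0.
by have := normr_ge0 (P q y); lra.
Qed.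

Section Nontrivial.
Variables (al be : R).
Hypotheses (hab : forall s, 0 <= s -> forall e : R, 0 < e ->
     exists t0 : R, forall t, t0 <= t -> s <= t -> a t s * b t s <= e)
  (al0 : 0 <= al) (be0 : 0 <= be) (al1 : 2 * al < 1)
  (hal : forall t s, 0 <= s -> s <= t ->
     (\int[mu]_(r in `[s, t]) (a t r * a r s * Lip (f r))%:E <= (al * a t s)%:E)%E)
  (hbe : forall s, 0 <= s ->
     (\int[mu]_(r in `[s, +oo[) (b r s * a r s * Lip (f r))%:E <= be%:E)%E)
  (kap1 : 2 * (1 - 2 * al)^-1 * be < 1)
  (q1 : 2 * al + (1 - 2 * al)^-1 * be < 1)
  (nz : exists2 z, z != 0 & E_ P 0 z).

(** The alternating sequence of the two functions consists of invariant graphs,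
    hence is a Cauchy sequence. *)
Lemma invariant_graph_unique phi psi :
  (forall n, invariant_graph_upto P U n phi) ->
  (forall n, invariant_graph_upto P U n psi) ->
  forall t xi, 0 <= t -> E t xi -> psi t xi = phi t xi.
Proof.
move=> hphi hpsi t xi t0 Exi.
pose Phi (n : nat) := if odd n then psi else phi.
have hPhi n : invariant_graph_upto P U n%:R (Phi n) by rewrite /Phi; case: ifP.
apply/eqP; rewrite -subr_eq0 -normr_le0; apply/ler_addgt0Pr => e e0; rewrite add0r.
have [N NP] := invariant_graphs_cauchy hA hT ha hb hP cf lf f0 hU uU hab
  al0 be0 al1 hal hbe nz hPhi q1 t0 Exi e0.
have := NP N.*2.+1 N.*2; rewrite /Phi /= odd_double /=; apply.
  by rewrite leqW// -addnn leq_addr.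
by rewrite -addnn leq_addr.
Qed.

(** All the requirements pass to the pointwise limit of the graphs pulled back from
    the horizons [n], because these are uniformly Lipschitz and the flow is
    continuous in its initial data. *)
Lemma invariant_graph_exists : exists phi, forall n, invariant_graph_upto P U n phi.
Proof.
have mf := dichotomy_lip_locally_integrable hA hT ha hP cf lf hal nz.
have /choice [Phi hPhi] : forall n : nat, exists phi, invariant_graph_upto P U n%:R phi.
  move=> n; exact: (invariant_graph_upto_exists hA hT ha hb hP cf lf f0 hU uU mf
    al0 be0 al1 hal hbe nz kap1 (ler0n R n)).
have Phi_cauchy := invariant_graphs_cauchy hA hT ha hb hP cf lf f0 hU uU hab
  al0 be0 al1 hal hbe nz hPhi q1.
pose phi r xi := limn (fun n => Phi n r xi).
have Phi_cvg r xi : 0 <= r -> E r xi -> forall e : R, 0 < e ->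
    exists N, forall n, (N <= n)%N -> `|Phi n r xi - phi r xi| <= e.
  move=> r0 Exi; have cv : cvgn (fun n => Phi n r xi).
    apply/cauchy_cvgP/cauchy_ballP => e e0.
    have e40 : 0 < e / 4 by lra.
    have [N NP] := Phi_cauchy r xi r0 Exi _ e40.
    pose B := [set y | `|y - Phi N r xi| <= e / 4].
    exists (B, B).
      by split; exists N => // m Nm; exact: NP.
    move=> [y y'] [/= By By']; rewrite -ball_normE /=.
    apply: le_lt_trans (ler_distD (Phi N r xi) _ _) _.
    by rewrite [`|Phi _ _ _ - y'|]distrC; move: By By'; rewrite /B /=; lra.
  move=> e e0; have /cvgrPdist_le/(_ e e0) [N _ NP] := cv.
  by exists N => n Nn; rewrite distrC; exact: NP.
have le0 (x K : R) : 0 <= K -> (forall e : R, 0 < e -> x <= K * e) -> x <= 0.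
  move=> K0 h; apply/ler_addgt0Pr => e e0; rewrite add0r.
  have K1 : 0 < K + 1 by lra.
  have e'0 : 0 < e / (K + 1) by rewrite divr_gt0.
  apply: le_trans (h _ e'0) _; rewrite mulrCA ler_piMr ?(ltW e0)//.
  by rewrite ler_pdivrMr//; lra.
exists phi => n r r0 _.
have [Nr NrP] := nat_above r.
have phi0 : phi r 0 = 0.
  have E00 : E r 0 by exists 0; rewrite // linear0.
  apply/eqP; rewrite -normr_le0; apply: (le0 _ 1) => // e e0; rewrite mul1r.
  have [N NP] := Phi_cvg r 0 r0 E00 e e0.
  have := NP (maxn N Nr) (leq_maxl _ _).
  have [-> _ _ _] := hPhi (maxn N Nr) r r0 (NrP _ (leq_maxr _ _)).
  by rewrite sub0r normrN.
split=> [//|xi Exi|xi xi' Exi Exi'|t xi rt _ Exi].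
- have [k k0 kP] := P_norm_bound hP r0.
  apply/eqP; rewrite -normr_le0; apply: (le0 _ k) => // e e0.
  have [N NP] := Phi_cvg r xi r0 Exi e e0.
  have := NP (maxn N Nr) (leq_maxl _ _); rewrite distrC => h.
  have [_ F1 _ _] := hPhi (maxn N Nr) r r0 (NrP _ (leq_maxr _ _)).
  rewrite -[P r _]subr0 -(F1 xi Exi) -linearB.
  by apply: le_trans (kP _) _; rewrite ler_wpM2l.
- rewrite -subr_le0; apply: (le0 _ 2) => // e e0.
  have [N NP] := Phi_cvg r xi r0 Exi e e0.
  have [N' N'P] := Phi_cvg r xi' r0 Exi' e e0.
  pose m := maxn N (maxn N' Nr).
  have Nm : (N <= m)%N by exact: leq_maxl.
  have N'm : (N' <= m)%N by rewrite /m !leq_max leqnn orbT.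
  have Nrm : (Nr <= m)%N by rewrite /m !leq_max leqnn !orbT.
  have [_ _ lip _] := hPhi m r r0 (NrP m Nrm).
  have := lip xi xi' Exi Exi'; have := NP m Nm; have := N'P m N'm.
  have -> : phi r xi - phi r xi' = (Phi m r xi - Phi m r xi') -
      ((Phi m r xi - phi r xi) - (Phi m r xi' - phi r xi')).
    by rewrite sub_interchange !subKr.
  have := ler_normB (Phi m r xi - Phi m r xi')
    ((Phi m r xi - phi r xi) - (Phi m r xi' - phi r xi')).
  have := ler_normB (Phi m r xi - phi r xi) (Phi m r xi' - phi r xi').
  by lra.
- have t0 := le_trans r0 rt.
  have [K K0 KP] := U_lipschitz hA cf lf hU uU mf r0 rt.
  have [k k0 kP] := P_norm_bound hP t0.
  set u := U t r (xi + phi r xi).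
  have [Nt NtP] := nat_above t.
  apply/eqP; rewrite -subr_eq0 -normr_le0.
  apply: (le0 _ ((1 + k) * K + k * K + 1)) => [|e e0].
    by rewrite !addr_ge0 ?mulr_ge0// addr_ge0.
  have [N NP] := Phi_cvg r xi r0 Exi e e0.
  have [N' N'P] := Phi_cvg t (P t u) t0 (E_P P t u) e e0.
  pose m := maxn N (maxn N' Nt).
  have Nm : (N <= m)%N by exact: leq_maxl.
  have N'm : (N' <= m)%N by rewrite /m !leq_max leqnn orbT.
  have tm : t <= m%:R by apply: NtP; rewrite /m !leq_max leqnn !orbT.
  have [_ _ _ inv] := hPhi m r r0 (le_trans rt tm).
  have [_ _ lip _] := hPhi m t t0 tm.
  set um := U t r (xi + Phi m r xi).
  have du : `|u - um| <= K * e.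
    apply: le_trans (KP _ _) _; rewrite ler_wpM2l//.
    by rewrite opprD addrACA subrr add0r distrC NP.
  have h1 := N'P m N'm.
  have h2 := lip _ _ (E_P P t um) (E_P P t u); rewrite -linearB in h2.
  have h3 := kP (um - u); rewrite [`|um - u|]distrC in h3.
  have h4 := ler_wpM2l k0 du.
  have h5 : `|Q t (u - um)| <= `|u - um| + k * `|u - um|.
    by apply: le_trans (ler_normB _ _) _; rewrite lerD2l.
  have -> : Q_ P t u - phi t (P t u) = Q t (u - um) +
      ((Phi m t (P t um) - Phi m t (P t u)) + (Phi m t (P t u) - phi t (P t u))).
    by rewrite [X in _ = _ + X]addrA subrK /Q Q_sub (inv t xi rt tm Exi) addrA subrK.
  apply: le_trans (ler_normD _ _) _.
  have := ler_normD (Phi m t (P t um) - Phi m t (P t u)) (Phi m t (P t u) - phi t (P t u)).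
  by lra.
Qed.

End Nontrivial.
End LimitGraph.

Section StandingHypotheses.
Context {R : realType} {X : completeNormedModType R}.
Local Notation mu := (@lebesgue_measure R).

Lemma continuous_family_eps (A : R -> {linear X -> X}) :
  continuous_family A -> family_continuous A.
Proof.
move=> [bA cA]; split=> [t t0|t t0 e e0].
  by apply: opnorm_lty_bound (bA t t0) => c x; rewrite linearZ.
have /(cA t t0) : nbhs (0%E : \bar R) [set y | (y < e%:E)%E].
  apply: open_nbhs_nbhs; split; first exact: open_ereal_lt_ereal.
  by rewrite /= lte_fin.
move=> h; have {h} : \forall r \near within `[0, +oo[ (nbhs t),
    (opnorm (fun x => A r x - A t x)%R < e%:E)%E by exact: h.
rewrite near_withinE => /nbhs_ballP [d /= d0 dP]; exists d => // r r0 rt x.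
have /ltW h : (opnorm (fun x => A r x - A t x)%R < e%:E)%E.
  apply: dP; first by rewrite /ball /= distrC.
  by rewrite /= in_itv /= r0.
by apply: (opnorm_bound _ h) => c y; rewrite (linearZZ (A r)) (linearZZ (A t)) scalerBr.
Qed.

Lemma field_continuous_eps (f : R -> X -> X) :
  {within `[0, +oo[ `*` setT, continuous (fun z : R * X => f z.1 z.2)} ->
  field_continuous f.
Proof.
move=> /subspace_continuousP cf t x t0 e e0.
have : (`[0, +oo[ `*` [set: X])%classic (t, x) by split; rewrite //= in_itv /= t0.
move=> /cf /cvgrPdist_lt/(_ e e0); rewrite near_withinE => /nbhs_ballP [d /= d0 dP].
exists d => // t' x' t'0 tt' xx'; rewrite distrC; apply: (dP (t', x')).
  by split; rewrite /= -ball_normE /= distrC.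
by split; rewrite //= in_itv /= t'0.
Qed.

Lemma alpha_bound (a : R -> R -> R) (f : R -> X -> X) :
  (forall t s, 0 <= s -> s <= t -> 0 < a t s) -> (alpha_ a f < +oo)%E ->
  0 <= fine (alpha_ a f) /\ forall t s, 0 <= s -> s <= t ->
    (\int[mu]_(r in `[s, t]) (a t r * a r s * Lip (f r))%:E <=
       (fine (alpha_ a f) * a t s)%:E)%E.
Proof.
move=> ha aoo.
have I0 t s : 0 <= s -> s <= t ->
    (0 <= \int[mu]_(r in `[s, t]) (a t r * a r s * Lip (f r))%:E)%E.
  move=> s0 st; apply: integral_ge0 => r; rewrite /= in_itv /= => /andP[sr rt].
  by rewrite lee_fin !mulr_ge0 ?Lip_ge0// ltW// ha// (le_trans s0).
have le_alpha t s : 0 <= s -> s < t -> (((a t s)^-1)%:E *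
    \int[mu]_(r in `[s, t]) (a t r * a r s * Lip (f r))%:E <= alpha_ a f)%E.
  by move=> s0 st; apply: ereal_sup_ubound; exists (t, s).
have alpha0 : (0 <= alpha_ a f)%E.
  apply: le_trans (le_alpha 1 0 (lexx _) ltr01); rewrite mule_ge0 ?I0//.
  by rewrite lee_fin invr_ge0 ltW// ha.
have fin : alpha_ a f \is a fin_num by rewrite ge0_fin_numE.
split=> [|t s s0]; first exact: fine_ge0.
rewrite le_eqVlt => /predU1P[<-|st].
  rewrite set_itv1 integral_set1 lee_fin mulr_ge0 ?fine_ge0//.
  by rewrite ltW// ha.
have a0 := ha t s s0 (ltW st).
rewrite mulrC EFinM fineK// -lee_pdivrMl//; exact: le_alpha.
Qed.

Lemma beta_bound (a b : R -> R -> R) (f : R -> X -> X) :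
  (forall t s, 0 <= s -> s <= t -> 0 < a t s) ->
  (forall t s, 0 <= s -> s <= t -> 0 < b t s) -> (beta_ a b f < +oo)%E ->
  0 <= fine (beta_ a b f) /\ forall s, 0 <= s ->
    (\int[mu]_(r in `[s, +oo[) (b r s * a r s * Lip (f r))%:E <=
       (fine (beta_ a b f))%:E)%E.
Proof.
move=> ha hb boo.
have le_beta s : 0 <= s ->
    (\int[mu]_(r in `[s, +oo[) (b r s * a r s * Lip (f r))%:E <= beta_ a b f)%E.
  by move=> s0; apply: ereal_sup_ubound; exists s.
have beta0 : (0 <= beta_ a b f)%E.
  apply: le_trans (le_beta 0 (lexx _)); apply: integral_ge0 => r.
  rewrite /= in_itv /= => /andP[r0 _].
  by rewrite lee_fin !mulr_ge0 ?Lip_ge0// ltW// (ha, hb).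
have fin : beta_ a b f \is a fin_num by rewrite ge0_fin_numE.
by split=> [|s s0]; [exact: fine_ge0 | rewrite fineK// le_beta].
Qed.

(** Here [sqrt be < 1 - 2 * al] is what makes the last constant less than [1]. *)
Lemma small_constants (al be : R) : 0 <= al -> 0 <= be ->
  2 * al + Num.max (2 * be) (Num.sqrt be) < 1 ->
  [/\ 2 * al < 1, 2 * (1 - 2 * al)^-1 * be < 1 &
      2 * al + (1 - 2 * al)^-1 * be < 1].
Proof.
move=> al0 be0 h; have sq := sqrtr_ge0 be.
have h1 : 2 * be <= Num.max (2 * be) (Num.sqrt be) by rewrite le_max lexx.
have h2 : Num.sqrt be <= Num.max (2 * be) (Num.sqrt be) by rewrite le_max lexx orbT.
have al1 : 0 < 1 - 2 * al by lra.
split; first by lra.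
- by rewrite mulrAC ltr_pdivrMr//; lra.
- suff : (1 - 2 * al)^-1 * be < 1 - 2 * al by lra.
  rewrite mulrC ltr_pdivrMr// -{1}(sqr_sqrtr be0) -expr2.
  by rewrite ltrXn2r//; lra.
Qed.

End StandingHypotheses.

Theorem theorem3p1 (R : realType) (X : completeNormedModType R)
  (A : R -> {linear X -> X})
  (hA : continuous_family A)
  (T : R -> R -> X -> X)
  (hT : solution_family (fun t x => A t x) T)
  (P : R -> {linear X -> X}) (a b : R -> R -> R)
  (ha : forall t s, 0 <= s -> s <= t -> 0 < a t s)
  (hb : forall t s, 0 <= s -> s <= t -> 0 < b t s)
  (hP : general_dichotomy T P a b)
  (f : R -> X -> X)
  (f_cont : {within `[0, +oo[ `*` setT,
               continuous (fun z : R * X => f z.1 z.2)})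
  (f_lip : forall t, 0 <= t -> [lipschitz f t x | x in setT])
  (f0 : forall t, 0 <= t -> f t 0 = 0)
  (U : R -> R -> X -> X)
  (hU : solution_family (fun t x => A t x + f t x) U)
  (uU : unique_solutions (fun t x => A t x + f t x))
  (hab : forall s, 0 <= s -> (a t s * b t s) @[t --> +oo] --> (0 : R))
  (halpha : (alpha_ a f < +oo)%E)
  (hbeta : (beta_ a b f < +oo)%E)
  (hsmall : 2 * fine (alpha_ a f)
            + Num.max (2 * fine (beta_ a b f))
                      (Num.sqrt (fine (beta_ a b f))) < 1) :
  exists phi : R -> X -> X,
    [/\ calX P phi /\ graph_invariant P U phi,
        forall psi, calX P psi -> graph_invariant P U psi ->
          forall t xi, G_ P (t, xi) -> psi t xi = phi t xi &
        forall t s xi xi', 0 <= s -> s <= t -> E_ P s xi -> E_ P s xi' ->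
          `|(Psi U (t - s) (s, xi + phi s xi)).2
            - (Psi U (t - s) (s, xi' + phi s xi')).2|
          <= 2 / (1 - 2 * fine (alpha_ a f)) * a t s * `|xi - xi'|].
Proof.
have fA := continuous_family_eps hA.
have cf := field_continuous_eps f_cont.
have lf : lip_field f by exact: f_lip.
have [al0 hal] := alpha_bound ha halpha.
have [be0 hbe] := beta_bound ha hb hbeta.
have [al1 kap1 q1] := small_constants al0 be0 hsmall.
have [nz|z] := pselect (exists2 z, z != 0 & E_ P 0 z); last first.
  have E0 := trivial_stable_space fA hT hP z.
  have Psi0 s tau : 0 <= s -> 0 <= tau -> Psi U tau (s, 0) = (s + tau, 0).
    move=> s0 tau0; rewrite /Psi /= (U_zero f0 hU uU)//.
    by rewrite lerDl.
  exists (fun _ _ => 0); split.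
  - split; first by split=> [//|t xi _|t xi xi' _ _]; rewrite ?subrr ?normr0 // /F_ /= linear0.
    move=> tau tau0 _ [_ [[s xi] [/= s0 Exi] <-] <-]; rewrite addr0.
    rewrite (E0 _ _ s0 Exi) Psi0//; exists (s + tau, 0); rewrite ?addr0//.
    by split => /=; [exact: addr_ge0 | exists 0; rewrite // linear0].
  - by move=> psi [psi0 _ _] _ t xi [/= t0 Exi]; rewrite (E0 _ _ t0 Exi) psi0.
  - move=> t s xi xi' s0 st Exi Exi'.
    by rewrite (E0 _ _ s0 Exi) (E0 _ _ s0 Exi') !addr0 !subrr !normr0 mulr0.
have hab' s : 0 <= s -> forall e : R, 0 < e ->
    exists t0 : R, forall t, t0 <= t -> s <= t -> a t s * b t s <= e.
  move=> s0 e e0; have /cvgrPdist_le/(_ e e0) [t0 [_ t0P]] := hab s s0.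
  exists (t0 + 1) => t t0t _; have := t0P t ltac:(lra).
  by rewrite sub0r normrN; apply: le_trans (ler_norm _).
have [phi hphi] := invariant_graph_exists fA hT ha hb hP cf lf f0 hU uU hab'
  al0 be0 al1 hal hbe kap1 q1 nz.
have Xphi : calX P phi.
  split=> [t t0|t xi [/= t0 Exi]|t xi xi' [/= t0 Exi] [/= _ Exi']].
  - by have [] := hphi t t t0 (lexx t).
  - by have [_ h _ _] := hphi t t t0 (lexx t); exact: h.
  - by have [_ _ h _] := hphi t t t0 (lexx t); exact: h.
exists phi; split.
- by split => //; apply/(graph_invariantP U hP Xphi).
- move=> psi Xpsi ipsi t xi [/= t0 Exi].
  have hpsi := (graph_invariantP U hP Xpsi).1 ipsi.
  exact: (invariant_graph_unique fA hT ha hb hP cf lf f0 hU uU hab'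
    al0 be0 al1 hal hbe q1 nz hphi hpsi).
- move=> t s xi xi' s0 st Exi Exi'; rewrite /Psi /= subrKC.
  have [_] := invariant_graph_decay fA hT ha hP cf lf hU al0 al1 hal nz
    (hphi t) s0 st (lexx t) Exi Exi'.
  by rewrite !mulrA.
Qed.
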